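(* Let $u,w\in\mathcal{D}(E)$ be such that $T=M_wEM_u$, $T(f)=wE(uf)$, is a bounded operator on $L^2(\Sigma)$, and let $0<p<\infty$. Then $T$ is $p$-hyponormal if and only if $T$ is normal.
   Context: $(X,\Sigma,\mu)$ is a complete $\sigma$-finite measure space and $\mathcal{A}\subseteq\Sigma$ is a sub-$\sigma$-algebra such that $\mu|_{\mathcal{A}}$ is $\sigma$-finite; functions are complex-valued, $L^2(\Sigma)=L^2(X,\Sigma,\mu)$, and all statements about functions and sets hold up to $\mu$-null sets. $L^0(\Sigma)$ (resp. $L^0(\mathcal{A})$) is the space of classes of a.e. finite-valued $\Sigma$-measurable (resp. $\mathcal{A}$-measurable) functions. $E=E^{\mathcal{A}}$ is the conditional expectation with respect to $\mathcal{A}$: $E(f)$ is the unique $\mathcal{A}$-measurable function with $\int_A f\,d\mu=\int_A E(f)\,d\mu$ for all $A\in\mathcal{A}$ for nonnegative measurable $f$ (values in $[0,\infty]$), similarly for $f\in L^2(\Sigma)$ (for $A$ of finite measure), and extended by linearity to $\mathcal{D}(E)=\{g\in L^0(\Sigma): E(|g|)\in L^0(\mathcal{A})\}$. $M_u$, $M_w$ denote multiplication by $u$, $w$, and $M_wEM_u$ is the operator $f\mapsto wE(uf)$; boundedness on $L^2(\Sigma)$ means in particular that $uf\in\mathcal{D}(E)$ for all $f\in L^2(\Sigma)$. A bounded operator $T$ on a Hilbert space is $p$-hyponormal ($0<p<\infty$) if $(T^*T)^p\geq (TT^* )^p$. *)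

(* Defs.v *)
From HB Require Import structures.
From mathcomp Require Import all_boot all_order all_algebra.
From mathcomp Require Import ring_quotient sesquilinear generic_quotient.
From mathcomp Require Import all_classical all_reals all_analysis.
From mathcomp Require Import measurable_realfun.
From mathcomp Require Import ring lra.
From mathcomp.real_closed Require Import complex.

Set Implicit Arguments.
Unset Strict Implicit.
Unset Printing Implicit Defensive.
Import Order.TTheory GRing.Theory Num.Theory.
Import numFieldTopology.Exports.
Import ComplexField.Normc.

Local Open Scope classical_set_scope.
Local Open Scope ring_scope.
Local Open Scope complex_scope.

(* Bounded operators on a complex inner product space, the inner product being
   linear in its first argument. *)
Section HilbertOperators.
Context (R : realType) (H : lmodType R[i]) (dot : {dot H for Num.conj}).
Implicit Types (S T : H -> H) (f g : H).

Definition hnorm f : R := Num.sqrt (complex.Re (dot f f)).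

Definition bounded_op T : Prop :=
  linear T /\ exists M : R, forall f, hnorm (T f) <= M * hnorm f.

Definition opnorm T : R := sup [set hnorm (T f) | f in [set f | hnorm f <= 1]].

Definition is_adjoint T S : Prop :=
  bounded_op S /\ forall f g, dot (T f) g = dot f (S g).

(* In R[i], 0 <= z means that z is real and nonnegative. *)
Definition op_le S T : Prop := forall f, 0 <= dot (T f - S f) f.

Definition op_horner (q : {poly R}) S f : H :=
  \sum_(i < size q) (q`_i)%:C *: iter i S f.

(* B = S^p, for S bounded and positive, by the continuous functional calculus:
   the spectrum of S lies in [0, opnorm S], and B is the limit in operator norm
   of q_n(S), for polynomials q_n converging to t `^ p uniformly on this
   interval. Any two such sequences give the same limit. *)
Definition is_op_powR (p : R) S (B : H -> H) : Prop :=
  bounded_op B /\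
  exists q : nat -> {poly R},
    (forall e : R, 0 < e -> \forall n \near \oo,
       forall t : R, 0 <= t <= opnorm S -> `|(q n).[t] - t `^ p| <= e) /\
    (fun n => opnorm (fun f => op_horner (q n) S f - B f)) @ \oo --> (0 : R).

Definition normal_op T : Prop :=
  exists S, is_adjoint T S /\ S \o T = T \o S.

Definition p_hyponormal (p : R) T : Prop :=
  exists S P Q, [/\ is_adjoint T S, is_op_powR p (S \o T) P,
    is_op_powR p (T \o S) Q & op_le Q P].

End HilbertOperators.


Section ComplexFunctions.
Context d (X : measurableType d) (R : realType) (mu : {measure set X -> \bar R}).
Implicit Types f g : X -> R[i].

Definition cmeasurable f : Prop :=
  measurable_fun setT (fun x => complex.Re (f x)) /\
  measurable_fun setT (fun x => complex.Im (f x)).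

Definition cintegral f : R[i] :=
  (\int[mu]_x complex.Re (f x))%R +i* (\int[mu]_x complex.Im (f x))%R.

Lemma normc2E (z : R[i]) : normc z ^+ 2 = complex.Re z ^+ 2 + complex.Im z ^+ 2.
Proof. by case: z => a b /=; rewrite sqr_sqrtr// addr_ge0// sqr_ge0. Qed.

Lemma cmeasurable_normc2 f : cmeasurable f ->
  measurable_fun setT (fun x => normc (f x) ^+ 2).
Proof.
move=> [mr mi]; under eq_fun do rewrite normc2E.
by apply: measurable_funD; apply: measurable_funX.
Qed.

Lemma cmeasurableD f g : cmeasurable f -> cmeasurable g ->
  cmeasurable (fun x => f x + g x).
Proof.
move=> [fr fi] [gr gi]; split.
- have -> : (fun x => complex.Re (f x + g x)) =
      (fun x => complex.Re (f x) + complex.Re (g x)).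
    by apply/funext => x; case: (f x); case: (g x).
  exact: measurable_funD.
- have -> : (fun x => complex.Im (f x + g x)) =
      (fun x => complex.Im (f x) + complex.Im (g x)).
    by apply/funext => x; case: (f x); case: (g x).
  exact: measurable_funD.
Qed.

Lemma cmeasurableM f g : cmeasurable f -> cmeasurable g ->
  cmeasurable (fun x => f x * g x).
Proof.
move=> [fr fi] [gr gi]; split.
- have -> : (fun x => complex.Re (f x * g x)) = (fun x =>
      complex.Re (f x) * complex.Re (g x) - complex.Im (f x) * complex.Im (g x)).
    by apply/funext => x; case: (f x); case: (g x).
  by apply: measurable_funB; apply: measurable_funM.
- have -> : (fun x => complex.Im (f x * g x)) = (fun x =>
      complex.Re (f x) * complex.Im (g x) + complex.Im (f x) * complex.Re (g x)).
    by apply/funext => x; case: (f x); case: (g x).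
  by apply: measurable_funD; apply: measurable_funM.
Qed.

Lemma cmeasurable_conj f : cmeasurable f -> cmeasurable (fun x => Num.conj (f x)).
Proof.
move=> [fr fi]; split.
- have -> : (fun x => complex.Re (Num.conj (f x))) = (fun x => complex.Re (f x)).
    by apply/funext => x; case: (f x).
  by [].
- have -> : (fun x => complex.Im (Num.conj (f x))) = (fun x => - complex.Im (f x)).
    by apply/funext => x; case: (f x).
  exact: measurableT_comp.
Qed.

Lemma cmeasurable_cst (c : R[i]) : cmeasurable (fun=> c).
Proof. by split; apply: measurable_cst. Qed.

Definition cintegrable f : Prop :=
  mu.-integrable setT (fun x => (complex.Re (f x))%:E) /\
  mu.-integrable setT (fun x => (complex.Im (f x))%:E).

Lemma cintegralD f g : cintegrable f -> cintegrable g ->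
  cintegral (fun x => f x + g x) = cintegral f + cintegral g.
Proof.
move=> [fr fi] [gr gi]; rewrite /cintegral; apply/eqP.
rewrite eq_complex /=; apply/andP; split; apply/eqP.
- rewrite -RintegralD//; apply: eq_Rintegral => x _.
  by case: (f x); case: (g x).
- rewrite -RintegralD//; apply: eq_Rintegral => x _.
  by case: (f x); case: (g x).
Qed.

Lemma cintegralZ (a : R[i]) f : cintegrable f ->
  cintegral (fun x => a * f x) = a * cintegral f.
Proof.
case: a => a b [fr fi]; rewrite /cintegral; apply/eqP.
have I c (h : X -> R) : mu.-integrable setT (fun x => (h x)%:E) ->
    mu.-integrable setT (fun x => (c * h x)%:E).
  by move=> Ih; exact: (integrableZl measurableT c Ih).
rewrite eq_complex /=; apply/andP; split; apply/eqP.
- rewrite -!RintegralZl// -RintegralB//; [|exact: I|exact: I].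
  by apply: eq_Rintegral => x _; case: (f x).
- rewrite -!RintegralZl// -RintegralD//; [|exact: I|exact: I].
  by apply: eq_Rintegral => x _; case: (f x).
Qed.

Lemma cintegrableZ (a : R[i]) f : cintegrable f -> cintegrable (fun x => a * f x).
Proof.
case: a => a b [fr fi].
have I c (h : X -> R) : mu.-integrable setT (fun x => (h x)%:E) ->
    mu.-integrable setT (fun x => (c * h x)%:E).
  by move=> Ih; exact: (integrableZl measurableT c Ih).
split.
- have := integrableB measurableT (I a _ fr) (I b _ fi).
  by congr (_.-integrable _ _); apply/funext => x /=; case: (f x).
- have := integrableD measurableT (I a _ fi) (I b _ fr).
  by congr (_.-integrable _ _); apply/funext => x /=; case: (f x).
Qed.

Lemma cintegral_conj f : cintegrable f ->
  cintegral (fun x => Num.conj (f x)) = Num.conj (cintegral f).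
Proof.
move=> [_ fi]; rewrite /cintegral; apply/eqP.
rewrite eq_complex /=; apply/andP; split; apply/eqP.
- by apply: eq_Rintegral => x _; case: (f x).
- rewrite -mulN1r -RintegralZl//; apply: eq_Rintegral => x _.
  by rewrite mulN1r; case: (f x).
Qed.

Lemma ae_eq_cintegral f g : cmeasurable f -> cmeasurable g ->
  {ae mu, forall x, f x = g x} -> cintegral f = cintegral g.
Proof.
move=> [fr fi] [gr gi] fg; rewrite /cintegral /Rintegral.
congr (fine _ +i* fine _); apply: ae_eq_integral => //;
  do ?[exact/measurable_EFinP];
  by apply: filterS fg => x /= -> _.
Qed.

Definition square_integrable f : Prop :=
  cmeasurable f /\ (\int[mu]_x (normc (f x) ^+ 2)%:E < +oo)%E.

Lemma square_integrableP f : square_integrable f <->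
  cmeasurable f /\ mu.-integrable setT (fun x => (normc (f x) ^+ 2)%:E).
Proof.
have E : (\int[mu]_x `|(normc (f x) ^+ 2)%:E| = \int[mu]_x (normc (f x) ^+ 2)%:E)%E.
  by apply: eq_integral => x _; rewrite gee0_abs// lee_fin sqr_ge0.
split=> -[mf fi]; split => //.
- apply/integrableP; split; last by rewrite E.
  exact/measurable_EFinP/cmeasurable_normc2.
- by move/integrableP : fi => [_]; rewrite E.
Qed.

Lemma square_integrable_prod f g : square_integrable f -> square_integrable g ->
  cintegrable (fun x => f x * Num.conj (g x)).
Proof.
move=> /square_integrableP[mf If] /square_integrableP[mg Ig].
have [mr mi] := cmeasurableM mf (cmeasurable_conj mg).
have Ifg := integrableD measurableT If Ig.
split; apply: le_integrable Ifg => //; try exact/measurable_EFinP.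
- move=> x _; rewrite /= lee_fin !normc2E [leRHS]ger0_norm; last first.
    by rewrite !addr_ge0// sqr_ge0.
  case: (f x) (g x) => [a b] [c e] /=.
  have := sqr_ge0 (a - c); have := sqr_ge0 (a + c).
  have := sqr_ge0 (b - e); have := sqr_ge0 (b + e).
  have := sqr_ge0 a; have := sqr_ge0 b; have := sqr_ge0 c; have := sqr_ge0 e.
  by rewrite ler_norml => *; apply/andP; split; nra.
- move=> x _; rewrite /= lee_fin !normc2E [leRHS]ger0_norm; last first.
    by rewrite !addr_ge0// sqr_ge0.
  case: (f x) (g x) => [a b] [c e] /=.
  have := sqr_ge0 (a - e); have := sqr_ge0 (a + e).
  have := sqr_ge0 (b - c); have := sqr_ge0 (b + c).
  have := sqr_ge0 a; have := sqr_ge0 b; have := sqr_ge0 c; have := sqr_ge0 e.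
  by rewrite ler_norml => *; apply/andP; split; nra.
Qed.

Definition L2fun_pred : {pred X -> R[i]} := [pred f | `[< square_integrable f >]].

Lemma L2fun_submod_closed : submod_closed L2fun_pred.
Proof.
split=> [|a f g].
  apply/asboolP/square_integrableP; split; first exact: cmeasurable_cst.
  under eq_fun do rewrite normc0 expr0n/=.
  exact: integrable0.
move=> /asboolP/square_integrableP[mf If] /asboolP/square_integrableP[mg Ig].
have mh := cmeasurableD (cmeasurableM (cmeasurable_cst a) mf) mg.
apply/asboolP/square_integrableP; split => //.
have I := integrableD measurableT
  (integrableZl measurableT (2 * normc a ^+ 2) If)
  (integrableZl measurableT 2 Ig).
apply: le_integrable I => //.
  exact/measurable_EFinP/(cmeasurable_normc2 mh).
move=> x _; rewrite /= lee_fin ger0_norm ?sqr_ge0// ger0_norm; last first.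
  by rewrite -mulrA -mulrDr pmulr_rge0// -exprMn addr_ge0// sqr_ge0.
rewrite -[(a *: f + g) x]/(a * f x + g x) !normc2E.
case: a {mh} (f x) (g x) => [a1 a2] [b1 b2] [c1 c2] /=.
set p := a1 * b1 - a2 * b2; set q := a1 * b2 + a2 * b1.
have -> : 2 * (a1 ^+ 2 + a2 ^+ 2) * (b1 ^+ 2 + b2 ^+ 2) =
  2 * (p ^+ 2 + q ^+ 2) by rewrite /p /q; ring.
have := sqr_ge0 (p - c1); have := sqr_ge0 (q - c2); nra.
Qed.

HB.instance Definition _ :=
  GRing.isSubmodClosed.Build _ _ L2fun_pred L2fun_submod_closed.

Record L2fun := MkL2fun {
  L2fun_val :> X -> R[i];
  L2fun_valP : L2fun_val \in L2fun_pred }.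

HB.instance Definition _ := [isSub for L2fun_val].
HB.instance Definition _ := [Choice of L2fun by <:].
HB.instance Definition _ := [SubChoice_isSubLmodule of L2fun by <:].

Definition L2null : {pred L2fun} :=
  [pred f : L2fun | `[< {ae mu, forall x, f x = 0} >]].

Lemma L2null_zmod_closed : zmod_closed L2null.
Proof.
split=> [|f g /asboolP f0 /asboolP g0]; apply/asboolP; first exact: aeW.
by apply: filterS2 f0 g0 => x fx gx; rewrite -[LHS]/(f x - g x) fx gx subrr.
Qed.

HB.instance Definition _ := GRing.isZmodClosed.Build _ L2null L2null_zmod_closed.

End ComplexFunctions.

Section L2.
Context d (X : measurableType d) (R : realType) (mu : {measure set X -> \bar R}).
Local Open Scope quotient_scope.

Definition L2 : Type := {ideal_quot (@L2null d X R mu)}.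

HB.instance Definition _ := Choice.on L2.
HB.instance Definition _ := GRing.Zmodule.on L2.
HB.instance Definition _ := Quotient.on L2.

Definition L2_repr (f : L2) : L2fun mu := repr f.

Definition L2_to_fun (f : L2) : X -> R[i] := L2fun_val (L2_repr f).
Local Coercion L2_to_fun : L2 >-> Funclass.

Lemma L2_piP (f g : L2fun mu) :
  \pi_L2 f = \pi_L2 g <-> {ae mu, forall x, f x = g x}.
Proof.
have -> : (\pi_L2 f = \pi_L2 g) <-> (f - g \in @L2null d X R mu).
  by rewrite Quotient.idealrBE; split=> /eqP.
split=> [/asboolP|] fg.
  by apply: filterS fg => x /= /eqP; rewrite subr_eq0 => /eqP.
by apply/asboolP; apply: filterS fg => x fgx; rewrite -[LHS]/(f x - g x) fgx subrr.
Qed.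

Lemma L2_pi_ae (f : L2fun mu) : {ae mu, forall x, (\pi_L2 f : L2) x = f x}.
Proof. by apply/L2_piP; rewrite /L2_repr reprK. Qed.

Lemma L2P (f g : L2) : f = g <-> {ae mu, forall x, f x = g x}.
Proof. by have := L2_piP (L2_repr f) (L2_repr g); rewrite /L2_repr !reprK. Qed.

Lemma L2_piD (f g : L2fun mu) : \pi_L2 (f + g) = \pi_L2 f + \pi_L2 g :> L2.
Proof. exact: Quotient.pi_add. Qed.

Definition L2_scale (a : R[i]) (f : L2) : L2 := \pi_L2 (a *: L2_repr f).

Lemma L2_scaleE a (f : L2fun mu) : L2_scale a (\pi_L2 f) = \pi_L2 (a *: f).
Proof.
apply/L2_piP; apply: filterS (L2_pi_ae f) => x fx.
by rewrite -[LHS]/(a * (\pi_L2 f : L2) x) fx.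
Qed.

Let L2_scaleA a b f : L2_scale a (L2_scale b f) = L2_scale (a * b) f.
Proof. by rewrite -[f]reprK (L2_scaleE b) !L2_scaleE scalerA. Qed.

Let L2_scale1 : left_id 1 L2_scale.
Proof. by move=> f; rewrite -[f]reprK L2_scaleE scale1r. Qed.

Let L2_scaleDr : right_distributive L2_scale +%R.
Proof.
by move=> a f g; rewrite -[f]reprK -[g]reprK -L2_piD !L2_scaleE scalerDr L2_piD.
Qed.

Let L2_scaleDl f : {morph L2_scale^~ f : a b / a + b}.
Proof.
by move=> a b; rewrite -[f]reprK !L2_scaleE scalerDl L2_piD.
Qed.

HB.instance Definition _ := GRing.Zmodule_isLmodule.Build R[i] L2
  L2_scaleA L2_scale1 L2_scaleDr L2_scaleDl.

Lemma L2_square_integrable (f : L2) : square_integrable mu f.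
Proof. by have /asboolP := L2fun_valP (L2_repr f). Qed.

Lemma L2_linE (a : R[i]) (f g : L2) :
  {ae mu, forall x, (a *: f + g : L2) x = a * f x + g x}.
Proof.
have -> : a *: f + g = \pi_L2 (a *: L2_repr f + L2_repr g).
  by rewrite L2_piD /L2_repr reprK.
exact: L2_pi_ae.
Qed.

Definition L2_dot (f g : L2) : R[i] :=
  cintegral mu (fun x => f x * Num.conj (g x)).

Let cmeas (f : L2) : cmeasurable f.
Proof. by case: (L2_square_integrable f). Qed.

Let cint (f g : L2) : cintegrable mu (fun x => f x * Num.conj (g x)).
Proof. by apply: square_integrable_prod; exact: L2_square_integrable. Qed.

Lemma L2_dot_conj (f g : L2) : L2_dot f g = Num.conj (L2_dot g f).
Proof.
rewrite /L2_dot -cintegral_conj//; congr cintegral; apply/funext => x.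
by rewrite rmorphM /= conjCK mulrC.
Qed.

Lemma L2_dot_linearl (g : L2) (a : R[i]) (f1 f2 : L2) :
  L2_dot (a *: f1 + f2) g = a * L2_dot f1 g + L2_dot f2 g.
Proof.
rewrite /L2_dot -cintegralZ//.
have Z : cintegrable mu (fun x => a * (f1 x * Num.conj (g x))).
  exact: cintegrableZ.
rewrite -cintegralD//; apply: ae_eq_cintegral.
- by apply: cmeasurableM => //; exact: cmeasurable_conj.
- have M (f : L2) := cmeasurableM (cmeas f) (cmeasurable_conj (cmeas g)).
  by apply: cmeasurableD => //; apply: cmeasurableM => //; exact: cmeasurable_cst.
- by apply: filterS (L2_linE a f1 f2) => x ->; rewrite mulrDl mulrA.
Qed.

Lemma L2_dot_bilinear : bilinear_for
  (GRing.Scale.Law.clone _ _ ( *%R ) _)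
  (GRing.Scale.Law.clone _ _ (Num.conj \; *%R) _) L2_dot.
Proof.
split=> [g a f1 f2|f a g1 g2] /=; first exact: L2_dot_linearl.
by rewrite L2_dot_conj L2_dot_linearl rmorphD rmorphM /= -!L2_dot_conj.
Qed.

HB.instance Definition _ :=
  bilinear_isBilinear.Build R[i] L2 L2 R[i] _ _ L2_dot L2_dot_bilinear.

Let L2_dot_hermitian (f g : L2) : L2_dot f g = (-1) ^+ false * Num.conj (L2_dot g f).
Proof. by rewrite expr0 mul1r -L2_dot_conj. Qed.

HB.instance Definition _ :=
  isHermitianSesquilinear.Build _ _ _ _ L2_dot L2_dot_hermitian.

Let L2_dot_gt0 (f : L2) : f != 0 -> 0 < L2_dot f f.
Proof.
move=> f0; have [mf If] := (square_integrableP _ _).1 (L2_square_integrable f).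
have E x : f x * Num.conj (f x) = (normc (f x) ^+ 2)%:C.
  by rewrite -normCK rmorphXn; case: (f x).
have -> : L2_dot f f = (\int[mu]_x (normc (f x) ^+ 2))%R%:C.
  rewrite /L2_dot /cintegral; congr Complex.
    by apply: eq_Rintegral => x _; rewrite E.
  transitivity (\int[mu]_(x in setT) (0 : R))%R.
    by apply: eq_Rintegral => x _; rewrite E.
  by rewrite Rintegral_cst// mul0r.
rewrite ltcR lt0r; apply/andP; split; last by apply: Rintegral_ge0 => x _; exact: sqr_ge0.
apply: contra f0 => /eqP I0; apply/eqP/L2P.
have /(ae_eq_integral_abs mu measurableT) : measurable_fun setT
    (fun x => (normc (f x) ^+ 2)%:E).
  by case/integrableP : If.
case=> + _ => H.
have : (\int[mu]_x `|(normc (f x) ^+ 2)%:E| = 0)%E.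
  transitivity (\int[mu]_x (normc (f x) ^+ 2)%:E)%E.
    by apply: eq_integral => x _; rewrite gee0_abs// lee_fin sqr_ge0.
  rewrite -[LHS]fineK; last exact: integrable_fin_num.
  by rewrite [fine _]I0.
move=> /H; apply: filterS2 (L2_pi_ae 0) => x x0 /(_ I) [] /eqP.
rewrite sqrf_eq0 => /eqP /eq0_normc ->.
have -> : (0 : L2) = \pi_L2 0 by rewrite piE.
by rewrite x0.
Qed.

HB.instance Definition _ := isDotProduct.Build _ _ L2_dot L2_dot_gt0.

End L2.
Coercion L2_to_fun : L2 >-> Funclass.

Section ConditionalExpectation.
Context d (X : measurableType d) (R : realType) (mu : {measure set X -> \bar R}).
Variable A : set (set X).

(* For f measurable and nonnegative, a version of E(f), unique up to mu-null
   sets when the restriction of mu to A is sigma-finite. *)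
Definition ge0_condexp (f : X -> \bar R) : X -> \bar R :=
  xget (cst 0%E) [set g | [/\ forall x, (0 <= g x)%E,
    measurable_fun setT (g : g_sigma_algebraType A -> \bar R) &
    forall B, A B -> (\int[mu]_(x in B) f x = \int[mu]_(x in B) g x)%E]].

Definition rcondexp (f : X -> R) (x : X) : R :=
  fine (ge0_condexp (fun y => (Num.max (f y) 0)%:E) x) -
  fine (ge0_condexp (fun y => (Num.max (- f y) 0)%:E) x).

Definition condexp (f : X -> R[i]) (x : X) : R[i] :=
  rcondexp (fun y => complex.Re (f y)) x +i* rcondexp (fun y => complex.Im (f y)) x.

Definition condexp_domain : set (X -> R[i]) :=
  [set f | cmeasurable f /\
    {ae mu, forall x, (ge0_condexp (fun y => (normc (f y))%:E) x < +oo)%E}].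

Definition is_MwEMu (u w : X -> R[i]) (T : L2 mu -> L2 mu) : Prop :=
  forall f : L2 mu, condexp_domain (fun x => u x * f x) /\
    {ae mu, forall x, T f x = w x * condexp (fun y => u y * f y) x}.

End ConditionalExpectation.

(* Main.v *)
Require Import Defs.
From HB Require Import structures.
From mathcomp Require Import all_boot all_order all_algebra.
From mathcomp Require Import ring_quotient sesquilinear generic_quotient.
From mathcomp Require Import all_classical all_reals all_analysis.
From mathcomp Require Import measurable_realfun.
From mathcomp Require Import ring lra zify.
From mathcomp.real_closed Require Import complex.
Set Implicit Arguments.
Unset Strict Implicit.
Unset Printing Implicit Defensive.
Import Order.TTheory GRing.Theory Num.Theory.
Import numFieldTopology.Exports.
Import ComplexField.Normc.
Local Open Scope classical_set_scope.
Local Open Scope ring_scope.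
Local Open Scope complex_scope.

(** The operator [T = M_w E M_u] is fibrewise of rank one: [T f = w phi_f], where
    [phi_f = E(u f)] is measurable for the smaller sigma-algebra, and [T] commutes
    with multiplication by bounded functions measurable for that sigma-algebra
    ([MwEMu_amul]); so does its adjoint [S].

    If [T] is normal then [T S = S T], so that both have the same [p]-th power; all
    there is to prove is that the power of a bounded positive operator exists.
    This is the continuous functional calculus ([op_powR_exists]): polynomials
    approximate [t^p] uniformly ([powR_approx]), a polynomial which is small on
    the interval from 0 to [opnorm N] has a small value at [N] ([op_horner_bound]),
    and the space of square integrable functions is complete ([L2_complete]). The
    second fact rests on Bernstein's representation of a positive polynomial
    ([truncated_moment_ge0]) instead of spectral theory.

    Conversely, the inequality between the powers is only used to show that the
    kernel of [T] is included in that of [S] ([p_hyponormal_ker]): on the kernel of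
    [T] the form of [(T S)^p] is nonpositive, and this power has the kernel of
    [T S]. For an operator of rank one, [T = w (x) v], this inclusion of kernels
    says that [w] and [v] are collinear, which is normality. Fibrewise, the
    argument reads as follows ([ker_sub_adjoint_ker_normal]). For all [f] and [g],
    [T] kills [phi_g f - phi_f g], hence so does [S], and
    [phi_g (S f) = phi_f (S g)]. In particular, where [phi_f] does not vanish,
    [S T f = c (S f)] and [T S f = c' (T f)] with [c = phi_(T f) / phi_f] and
    [c' = phi_(S f) / phi_f]; similarly [T T f = c (T f)] and [S S f = c' (S f)].
    With [t = E((T f) conj f)], the equality [<T T f, f> = <f, S S f>], localized,
    gives [c t = conj c' t]. Hence [E(|T f|^2) = conj c t] and
    [E(|S f|^2) = c' t] are equal, from which [S T f = T S f] follows. Division is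
    avoided by working with bounded multiples of the functions [phi_f].

    Conditional expectations of nonnegative functions are obtained from the
    Radon-Nikodym theorem ([condexp_exists]); they are unique ([condexp_unique])
    and nonnegative multipliers can be pulled out of them ([condexp_pull_out]). *)

(** * Bernstein polynomials *)

Lemma mul_bin_trinomial n k j : (j <= k)%N -> (k <= n)%N ->
  ('C(n, k) * 'C(k, j) = 'C(n, j) * 'C(n - j, k - j))%N.
Proof.
move=> jk kn; have jn := leq_trans jk kn.
apply/eqP; rewrite -(eqn_pmul2r (fact_gt0 j)) -(eqn_pmul2r (fact_gt0 (k - j))).
rewrite -(eqn_pmul2r (fact_gt0 (n - k))); apply/eqP.
have e1 := bin_fact kn; have e2 := bin_fact jk; have e3 := bin_fact jn.
have := @bin_fact (n - j) (k - j); rewrite leq_sub2r// subnBA// subnK// => /(_ isT) e4.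
transitivity (n`!).
  by rewrite -e1 -e2; lia.
by rewrite -e3 -e4; lia.
Qed.

(** The binomial expansion of [(y + x)^(n - j)]: in degree [n], the Bernstein
    coefficients of [x^j] are the ratios ['C(k, j) / 'C(n, j)]. *)
Lemma bernstein_monomial (K : comNzRingType) (x y : K) n j : (j <= n)%N ->
  (x ^+ j * (y + x) ^+ (n - j)) *+ 'C(n, j) =
  \sum_(k < n.+1) (y ^+ (n - k) * x ^+ k) *+ ('C(n, k) * 'C(k, j)).
Proof.
move=> jn; rewrite exprDn mulr_sumr -sumrMnl.
rewrite -(big_mkord xpredT
  (fun k => (y ^+ (n - k) * x ^+ k) *+ ('C(n, k) * 'C(k, j)))).
rewrite (big_cat_nat (n := j))//=; last by rewrite ltnW.
rewrite [X in _ = X + _]big_nat_cond [X in _ = X + _]big1 ?add0r; last first.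
  by move=> k /andP[/andP[_ kj] _]; rewrite [X in (_ * X)%N]bin_small ?muln0 ?mulr0n.
rewrite -[X in \sum_(X <= _ < _) _]add0n big_addn subSn // big_mkord.
apply: eq_bigr => -[i /= ilt] _.
have ij : (i + j <= n)%N by lia.
rewrite mul_bin_trinomial ?leq_addl// addnK mulrnAr -mulrnA mulnC; congr (_ *+ _).
by rewrite mulrCA -exprD addnC [(n - j - i)%N]subnAC -subnDA.
Qed.

Section BernsteinEstimate.
Context {R : realType}.

Lemma bin_ratio_le1 n k j : (j <= n)%N -> (k <= n)%N ->
  0 <= 'C(k, j)%:R / 'C(n, j)%:R :> R /\ 'C(k, j)%:R / 'C(n, j)%:R <= 1 :> R.
Proof.
move=> jn kn; split; rewrite ?divr_ge0// ler_pdivrMr ?mul1r ?ltr0n ?bin_gt0//.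
by rewrite ler_nat leq_bin2l.
Qed.

(** The ratio and the power are products of [j] factors between 0 and 1, namely
    [(k - i) / (n - i)] for [i < j] and [k / n], and corresponding factors differ
    by at most [j / n]. *)
Lemma bin_ratio_approx n k j : (j <= n)%N -> (k <= n)%N -> (0 < n)%N ->
  `|'C(k, j)%:R / 'C(n, j)%:R - (k%:R / n%:R) ^+ j| <= (j ^ 2)%:R / n%:R :> R.
Proof.
move=> jn kn n0; elim: j jn => [|j IH] jn.
  by rewrite !bin0 expr0 divr1 subrr normr0 mul0r.
have {}IH := IH (ltnW jn).
have n0R : 0 < n%:R :> R by rewrite ltr0n.
have kn0 : 0 <= k%:R / n%:R :> R by rewrite divr_ge0.
have kn1 : k%:R / n%:R <= 1 :> R by rewrite ler_pdivrMr// mul1r ler_nat.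
have nj0 : 0 < (n - j)%:R :> R by rewrite ltr0n subn_gt0.
have -> : 'C(k, j.+1)%:R / 'C(n, j.+1)%:R =
    'C(k, j)%:R / 'C(n, j)%:R * ((k - j)%:R / (n - j)%:R) :> R.
  have := mul_bin_left k j; have := mul_bin_left n j.
  move=> /(congr1 (fun x => x%:R : R)); rewrite !natrM => e1.
  move=> /(congr1 (fun x => x%:R : R)); rewrite !natrM => e2.
  have nj1 := lt0r_neq0 nj0.
  have b0 : 'C(n, j)%:R != 0 :> R by rewrite pnatr_eq0 -lt0n bin_gt0 ltnW.
  have b1 : 'C(n, j.+1)%:R != 0 :> R by rewrite pnatr_eq0 -lt0n bin_gt0.
  apply/eqP; rewrite mulf_div eqr_div ?mulf_neq0//.
  have j0 : j.+1%:R != 0 :> R by rewrite pnatr_eq0.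
  apply/eqP; apply: (mulfI j0).
  transitivity ((j.+1%:R * 'C(k, j.+1)%:R) * ('C(n, j)%:R * (n - j)%:R) : R); first by ring.
  rewrite e2.
  transitivity (('C(k, j)%:R * (k - j)%:R) * ((n - j)%:R * 'C(n, j)%:R) : R); first by ring.
  by rewrite -e1; ring.
have d1 : `|(k - j)%:R / (n - j)%:R - k%:R / n%:R| <= j%:R / n%:R :> R.
  have [kj|jk] := leqP k j.
    have -> : (k - j = 0)%N by apply/eqP; rewrite subn_eq0.
    by rewrite mul0r sub0r normrN ger0_norm// ler_pM2r ?invr_gt0// ler_nat.
  have -> : (k - j)%:R / (n - j)%:R - k%:R / n%:R =
      - (j%:R / n%:R * ((n - k)%:R / (n - j)%:R)) :> R.
    rewrite natrB ?(ltnW jk)// (natrB _ kn) (natrB _ (ltnW jn)).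
    move: nj0; rewrite (natrB _ (ltnW jn)) => nj0.
    by field; rewrite !gt_eqF.
  rewrite normrN ger0_norm ?mulr_ge0 ?invr_ge0//.
  rewrite ler_piMr ?divr_ge0// ler_pdivrMr// mul1r ler_nat; lia.
have [r0 r1] := bin_ratio_le1 (ltnW jn) kn.
move: r0 r1 IH d1 kn0 kn1.
set r := 'C(k, j)%:R / 'C(n, j)%:R; set s := (_ / (n - j)%:R); set t := k%:R / _.
move=> r0 r1 IH d1 kn0 kn1.
have -> : r * s - t ^+ j.+1 = r * (s - t) + (r - t ^+ j) * t by rewrite exprSr; ring.
rewrite (le_trans (ler_normD _ _))// (normrM r) (normrM (r - _)) (ger0_norm r0) (ger0_norm kn0).
apply: (@le_trans _ _ (j%:R / n%:R + (j ^ 2)%:R / n%:R)).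
  apply: lerD; first by rewrite -[leRHS]mul1r ler_pM.
  by rewrite -[leRHS]mulr1 ler_pM.
by rewrite -mulrDl ler_pM2r ?invr_gt0// -natrD ler_nat; nia.
Qed.

(** Each [X^k (M - X)^(n - k)] is a square times [1], [X], [M - X] or
    [X (M - X)], so that [L] is nonnegative on it. Hence [L q >= - C / n] for all
    large [n], because the Bernstein coefficients of [q] of order [n] are within
    [O(1 / n)] of the values of [q] at the points [M k / n]. *)
Lemma truncated_moment_ge0 (L : {scalar {poly R}}) (M : R) : 0 < M ->
  (forall s : {poly R}, 0 <= L (s ^+ 2)) ->
  (forall s : {poly R}, 0 <= L (s ^+ 2 * 'X)) ->
  (forall s : {poly R}, 0 <= L (s ^+ 2 * (M%:P - 'X))) ->
  forall q, (forall t : R, 0 <= t <= M -> 0 <= q.[t]) -> 0 <= L q.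
Proof.
move=> M0 L1 LX LY q q0.
pose b n k : {poly R} := (M%:P - 'X) ^+ (n - k) * 'X ^+ k.
have b_ge0 n k : 0 <= L (b n k).
  rewrite /b -[(n - k)%N]odd_double_half -[k in X in _ * X]odd_double_half.
  set i := (_./2); set j := (k./2).
  rewrite -!muln2 !exprD !exprM.
  set y := (M%:P - 'X : {poly R}).
  case: (odd (n - k)); case: (odd k); rewrite ?expr1 ?expr0 ?mul1r.
  - (* [M X (M - X) = X (M - X)^2 + (M - X) X^2]. *)
    have -> : y * y ^+ i ^+ 2 * ('X * 'X^j ^+ 2) =
      M^-1 *: ((y * y ^+ i * 'X^j) ^+ 2 * 'X + ('X * y ^+ i * 'X^j) ^+ 2 * (M%:P - 'X)).
      have <- : M%:P * (y * y ^+ i ^+ 2 * ('X * 'X^j ^+ 2)) =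
        (y * y ^+ i * 'X^j) ^+ 2 * 'X + ('X * y ^+ i * 'X^j) ^+ 2 * (M%:P - 'X).
        by rewrite /y; ring.
      by rewrite mul_polyC scalerA mulVf ?gt_eqF// scale1r.
    by rewrite linearZ linearD /= mulr_ge0 ?addr_ge0// invr_ge0 ltW.
  - have -> : y * y ^+ i ^+ 2 * 'X^j ^+ 2 = (y ^+ i * 'X^j) ^+ 2 * y by ring.
    exact: LY.
  - have -> : y ^+ i ^+ 2 * ('X * 'X^j ^+ 2) = (y ^+ i * 'X^j) ^+ 2 * 'X by ring.
    exact: LX.
  - by rewrite -exprMn.
have Mn0 n : M ^+ n != 0 by rewrite expf_neq0 ?gt_eqF.
have LXj n j : (j <= n)%N -> L 'X^j = M ^+ j *
    \sum_(k < n.+1) ('C(n, k)%:R * L (b n k) / M ^+ n) * ('C(k, j)%:R / 'C(n, j)%:R).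
  move=> jn; have b0 : 'C(n, j)%:R != 0 :> R by rewrite pnatr_eq0 -lt0n bin_gt0.
  have := bernstein_monomial 'X (M%:P - 'X) jn.
  rewrite subrK -polyC_exp mulrC mul_polyC => /(congr1 L).
  rewrite linearMn linearZ/= raddf_sum/= => e.
  apply: (mulfI (mulf_neq0 (Mn0 (n - j)%N) b0)).
  rewrite -mulr_natr mulrAC in e; rewrite [LHS]e.
  rewrite mulrA mulr_sumr; apply: eq_bigr => k _.
  rewrite raddfMn/= -[L _ *+ _]mulr_natr natrM /b.
  have -> : M ^+ n = M ^+ (n - j) * M ^+ j by rewrite -exprD subnK.
  by field; rewrite !Mn0 b0.
(* [D / n] bounds the error on the Bernstein coefficients of order [n]. *)
pose D := \sum_(j < size q) `|q`_j| * M ^+ j * (j ^ 2)%:R.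
have D0 : 0 <= D by apply: sumr_ge0 => j _; rewrite !mulr_ge0// exprn_ge0// ltW.
have Lq n : (size q <= n)%N -> (0 < n)%N -> - (D * L 1) / n%:R <= L q.
  move=> qn n0; pose w (k : 'I_n.+1) := 'C(n, k)%:R * L (b n k) / M ^+ n.
  have w0 k : 0 <= w k by rewrite divr_ge0 ?mulr_ge0// exprn_ge0// ltW.
  have Ew : L 1 = \sum_k w k.
    rewrite -(expr0 'X) (LXj n 0)// expr0 mul1r; apply: eq_bigr => k _.
    by rewrite !bin0 divr1 mulr1.
  have -> : L q = \sum_k w k *
      \sum_(j < size q) q`_j * (M ^+ j * ('C(k, j)%:R / 'C(n, j)%:R)).
    rewrite -[in LHS](coefK q) poly_def raddf_sum/=.
    under [RHS]eq_bigr do rewrite mulr_sumr.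
    rewrite exchange_big/=; apply: eq_bigr => j _.
    rewrite linearZ/= (LXj n) ?(leq_trans (ltnW (ltn_ord j)))// !mulr_sumr.
    by apply: eq_bigr => k _; rewrite /w; ring.
  have -> : - (D * L 1) / n%:R = \sum_k w k * (- D / n%:R).
    by rewrite Ew -mulr_suml; ring.
  apply: ler_sum => k _; apply: ler_wpM2l => //.
  have kn : (k <= n)%N by rewrite -ltnS.
  have : 0 <= q.[M * (k%:R / n%:R)].
    apply: q0; rewrite mulr_ge0 ?divr_ge0// ?(ltW M0)//= ler_piMr ?(ltW M0)//.
    by rewrite ler_pdivrMr ?ltr0n// mul1r ler_nat.
  rewrite horner_coef; set B := \sum_(_ < _) _ => B0; set C := \sum_(_ < _) _.
  have : `|C - B| <= D / n%:R.
    rewrite -sumrB (le_trans (ler_norm_sum _ _ _))// mulr_suml.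
    apply: ler_sum => j _; rewrite exprMn -mulrBr -mulrBr !normrM.
    rewrite [`|M ^+ j|]ger0_norm ?exprn_ge0 ?(ltW M0)// -!mulrA.
    apply: ler_wpM2l => //; apply: ler_wpM2l; first by rewrite exprn_ge0 ?(ltW M0).
    by apply: bin_ratio_approx; rewrite ?(leq_trans (ltnW (ltn_ord j))).
  by rewrite ler_norml mulNr => /andP[+ _]; lra.
rewrite leNgt; apply/negP => Lq0.
have DL0 : 0 <= D * L 1 by rewrite mulr_ge0// -[1](expr1n _ 2).
pose n := maxn (size q) (Num.bound (D * L 1 / - L q)).+1.
have nlt : D * L 1 / - L q < n%:R.
  rewrite (lt_le_trans (archi_boundP _))// ?divr_ge0 ?oppr_ge0 ?(ltW Lq0)//.
  by rewrite ler_nat /n leq_max leqnSn orbT.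
have n0 : (0 < n)%N by rewrite /n leq_max orbT.
have := Lq n (leq_maxl _ _) n0; rewrite leNgt => /negP; apply.
rewrite mulNr ltrNr ltr_pdivrMr ?ltr0n// [ltRHS]mulrC -ltr_pdivrMr ?oppr_gt0//.
Qed.

End BernsteinEstimate.

(** * Uniform approximation of powers by polynomials *)

Section PowerApproximation.
Context {R : realType}.

Let bcoef n (t : R) k : R := ((1 - t) ^+ (n - k) * t ^+ k) *+ 'C(n, k).

Let bcoef_ge0 n t k : 0 <= t <= 1 -> 0 <= bcoef n t k.
Proof.
by move=> /andP[t0 t1]; rewrite mulrn_wge0// mulr_ge0// exprn_ge0// subr_ge0.
Qed.

Let bcoef_moment n j t : (j <= n)%N ->
  \sum_(k < n.+1) bcoef n t k * 'C(k, j)%:R = t ^+ j *+ 'C(n, j).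
Proof.
move=> jn; have := bernstein_monomial t (1 - t) jn.
rewrite subrK expr1n mulr1 => ->; apply: eq_bigr => k _.
by rewrite /bcoef mulrnA mulr_natr.
Qed.

Let sqr_bin2 m : m%:R ^+ 2 = 2 * 'C(m, 2)%:R + m%:R :> R.
Proof.
rewrite -natrX -natrM -natrD; congr _%:R.
by case: m => // m; have := mul_bin_diag m.+1 1; rewrite bin1 /=; nia.
Qed.

(** This is the variance of the binomial law, read off from the Bernstein forms
    of [1], [t] and [t^2]. *)
Lemma bernstein_variance n t : (1 < n)%N ->
  \sum_(k < n.+1) bcoef n t k * (k%:R - n%:R * t) ^+ 2 = n%:R * t * (1 - t).
Proof.
move=> n1; have e0 := bcoef_moment t (leq0n n).
have e1 := bcoef_moment t (ltnW n1); have e2 := bcoef_moment t n1.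
transitivity (2 * (\sum_(k < n.+1) bcoef n t k * 'C(k, 2)%:R)
  + (1 - 2 * n%:R * t) * (\sum_(k < n.+1) bcoef n t k * 'C(k, 1)%:R)
  + (n%:R * t) ^+ 2 * (\sum_(k < n.+1) bcoef n t k * 'C(k, 0)%:R)).
  rewrite !mulr_sumr -!big_split/=; apply: eq_bigr => k _.
  rewrite bin1 bin0 sqrrB (sqr_bin2 k).
  move: (bcoef n t k) ('C(k, 2)%:R : R) (k%:R : R) (n%:R : R) => b c x y; ring.
rewrite e0 e1 e2 bin1 bin0 expr0 -[_ *+ 'C(n, 2)]mulr_natr -[t ^+ 1 *+ n]mulr_natr.
have := sqr_bin2 n => e.
move: ('C(n, 2)%:R : R) (n%:R : R) e => c x e.
have {e} -> : c = (x ^+ 2 - x) / 2 by rewrite e; field.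
by field.
Qed.

(** A modulus of continuity valid for all exponents: for [x = s y] with
    [s <= 1], Bernoulli's inequality for an integer [m >= p] gives
    [1 - s^p <= m (1 - s)], hence [y^p - x^p <= (m / y) (y - x)]. This is used for
    [y] above the threshold [e^(1 / p)]; below it, [y^p <= e]. *)
Lemma powR_modulus (p e : R) : 0 < p -> 0 < e -> exists2 K, 0 <= K &
  forall x y : R, 0 <= x <= 1 -> 0 <= y <= 1 -> `|x `^ p - y `^ p| <= e + K * `|x - y|.
Proof.
move=> p0 e0; have [m pm] : exists m, p <= m%:R.
  by exists (Num.bound p); exact/ltW/archi_boundP/ltW.
pose dl := e `^ p^-1.
have dl0 : 0 < dl by rewrite powR_gt0.
exists (m%:R / dl) => [|x y]; first by rewrite divr_ge0// ltW.
wlog xy : x y / x <= y.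
  move=> H hx hy; have [xy|/ltW yx] := leP x y; first exact: H.
  by rewrite distrC (distrC x); apply: H.
move=> /andP[x0 x1] /andP[y0 y1].
rewrite (distrC x) (distrC (x `^ p)) !ger0_norm ?subr_ge0//; last first.
  by apply: ge0_ler_powR; rewrite ?nnegrE// ltW.
have [yd|dy] := leP y dl.
  rewrite (@le_trans _ _ e)//; last by rewrite lerDl mulr_ge0 ?subr_ge0// divr_ge0// ltW.
  rewrite lerBlDr ler_wpDr ?powR_ge0//.
  have -> : e = dl `^ p by rewrite /dl -powRrM mulVf ?gt_eqF// powRr1// ltW.
  by apply: ge0_ler_powR; rewrite ?nnegrE// ltW.
have y_gt0 : 0 < y by exact: lt_trans dy.
pose s := x / y.
have s0 : 0 <= s by rewrite divr_ge0.
have s1 : s <= 1 by rewrite ler_pdivrMr// mul1r.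
have sp : 1 - m%:R * (1 - s) <= s `^ p.
  rewrite (@le_trans _ _ (s ^+ m))//.
    elim: m {pm} => [|k IH]; first by rewrite mul0r subr0 expr0.
    rewrite exprS -natr1 (le_trans _ (ler_wpM2l s0 IH))//.
    have : 0 <= k%:R * (1 - s) ^+ 2 by rewrite mulr_ge0// sqr_ge0.
    by lra.
  rewrite -powR_mulrn//.
  have [->|sn0] := eqVneq s 0; first by rewrite !powR0 ?gt_eqF// (lt_le_trans p0).
  by apply: ger_powR => //; rewrite s1 lt0r sn0 s0.
have -> : x = s * y by rewrite /s divfK// gt_eqF.
rewrite powRM//; apply: ler_wpDl; first exact: ltW.
have yp0 := powR_ge0 y p.
have yp1 : y `^ p <= 1.
  have := @ge0_ler_powR _ p (ltW p0) y 1; rewrite powR1; apply; rewrite ?nnegrE//.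
apply: (@le_trans _ _ (y `^ p * (m%:R * (1 - s)))); first by nra.
have -> : y - s * y = (1 - s) * y by ring.
apply: (@le_trans _ _ (m%:R * (1 - s))).
  by rewrite ler_piMl// mulr_ge0// subr_ge0.
have -> : m%:R / dl * ((1 - s) * y) = m%:R * (1 - s) * (y / dl) by ring.
by rewrite ler_peMr ?mulr_ge0 ?subr_ge0// ler_pdivlMr// mul1r ltW.
Qed.

(** Chebyshev's argument for the Bernstein polynomials of [t^p]. *)
Lemma powR_approx01 (p e : R) : 0 < p -> 0 < e ->
  exists q : {poly R}, forall t, 0 <= t <= 1 -> `|q.[t] - t `^ p| <= e.
Proof.
move=> p0 e0; have e3 : 0 < e / 3 by lra.
have [K K0 Kmod] := powR_modulus p0 e3.
have K1 : 0 < K + 1 by lra.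
have [h h0 Kh] : exists2 h, 0 < h & K * h <= e / 3.
  exists (e / 3 / (K + 1)); first by rewrite divr_gt0.
  by rewrite mulrCA ler_piMr ?(ltW e3)// ler_pdivrMr//; lra.
have [n n1 nK] : exists2 n, (1 < n)%N & K / h / n%:R <= e / 3.
  exists (Num.bound (K / h / (e / 3))).+2 => //.
  rewrite ler_pdivrMr ?ltr0n// [leRHS]mulrC -ler_pdivrMr//.
  apply: (@le_trans _ _ (Num.bound (K / h / (e / 3)))%:R).
    by apply/ltW/archi_boundP; rewrite !divr_ge0 ?(ltW h0) ?(ltW e0).
  by rewrite ler_nat; apply: leq_trans (leqnSn _) (leqnSn _).
have n0 : 0 < n%:R :> R by rewrite ltr0n ltnW.
exists (\sum_(k < n.+1) ((k%:R / n%:R) `^ p *+ 'C(n, k)) *: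
         ((1 - 'X) ^+ (n - k) * 'X ^+ k)) => t t01.
have -> : (\sum_(k < n.+1) ((k%:R / n%:R) `^ p *+ 'C(n, k)) *:
         ((1 - 'X) ^+ (n - k) * 'X ^+ k)).[t] =
       \sum_(k < n.+1) bcoef n t k * (k%:R / n%:R) `^ p.
  rewrite horner_sum; apply: eq_bigr => k _.
  by rewrite /bcoef !hornerE/= !mulrnAl -mulrA mulrC.
have E1 : \sum_(k < n.+1) bcoef n t k = 1.
  have := bcoef_moment t (leq0n n); rewrite bin0 expr0 mulr1n => <-.
  by apply: eq_bigr => k _; rewrite bin0 mulr1.
rewrite -[X in _ - X]mul1r -[X in _ - X * _]E1 mulr_suml -sumrB.
rewrite (le_trans (ler_norm_sum _ _ _))//.
have V := bernstein_variance t n1.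
apply: (@le_trans _ _ (\sum_(k < n.+1) (bcoef n t k * (e / 3 + K * h) +
    K / h / n%:R ^+ 2 * (bcoef n t k * (k%:R - n%:R * t) ^+ 2)))).
  apply: ler_sum => k _; rewrite -mulrBr normrM ger0_norm ?bcoef_ge0//.
  rewrite [X in _ <= _ + X]mulrCA -mulrDr ler_wpM2l ?bcoef_ge0//.
  have kn : 0 <= (k%:R / n%:R : R) <= 1.
    by rewrite divr_ge0//= ler_pdivrMr// mul1r ler_nat -ltnS.
  rewrite (le_trans (Kmod _ _ kn t01))// -addrA lerD2l.
  set a := k%:R / n%:R - t.
  have -> : k%:R - n%:R * t = n%:R * a.
    by rewrite /a mulrBr mulrCA mulfV ?mulr1// gt_eqF.
  have -> : K / h / n%:R ^+ 2 * (n%:R * a) ^+ 2 = K * (a ^+ 2 / h).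
    by field; rewrite !gt_eqF.
  rewrite -mulrDr ler_wpM2l//.
  (* [|a| <= h + a^2 / h], where the second term sums to a variance. *)
  have [ah|ha] := leP `|a| h; first by rewrite ler_wpDr// divr_ge0 ?sqr_ge0// ltW.
  rewrite ler_wpDl ?(ltW h0)// ler_pdivlMr// -real_normK ?num_real// expr2.
  by rewrite ler_wpM2l// ltW.
rewrite big_split/= -mulr_suml -mulr_sumr E1 V mul1r.
have : K / h / n%:R ^+ 2 * (n%:R * t * (1 - t)) <= K / h / n%:R.
  have -> : K / h / n%:R ^+ 2 * (n%:R * t * (1 - t)) = K / h / n%:R * (t * (1 - t)).
    by field; rewrite !gt_eqF.
  rewrite ler_piMr ?divr_ge0 ?(ltW h0) ?(ltW n0)//; nra.
lra.
Qed.

Lemma powR_approx (p M e : R) : 0 < p -> 0 < e ->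
  exists q : {poly R}, forall t, 0 <= t <= M -> `|q.[t] - t `^ p| <= e.
Proof.
move=> p0 e0; pose m := Num.max M 1.
have m0 : 0 < m by rewrite lt_max ltr01 orbT.
have mp0 : 0 < m `^ p by rewrite powR_gt0.
have [q Hq] := powR_approx01 p0 (divr_gt0 e0 mp0).
exists (m `^ p *: (q \Po (m^-1 *: 'X))) => t /andP[t0 tM].
have tm : 0 <= t / m <= 1.
  rewrite divr_ge0 ?(ltW m0)//= ler_pdivrMr// mul1r (le_trans tM)//.
  by rewrite le_max lexx.
have /andP[tm0 _] := tm.
rewrite hornerZ horner_comp hornerZ hornerX [m^-1 * t]mulrC.
have -> : t `^ p = m `^ p * (t / m) `^ p.
  by rewrite -powRM ?(ltW m0)// mulrC divfK// gt_eqF.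
rewrite -mulrBr normrM ger0_norm ?powR_ge0// -ler_pdivlMl// [leRHS]mulrC.
exact: Hq.
Qed.

End PowerApproximation.

(** * Inner products, norms and bounded operators *)

Section InnerProduct.
Context (R : realType) (H : lmodType R[i]) (dot : {dot H for Num.conj}).
Implicit Types (f g h : H) (a : R).

(** The real part of the inner product, a real inner product with the same norm.
    Positive operators are only tested against it. *)
Definition rdot f g : R := complex.Re (dot f g).
Local Notation norm := (@hnorm R H dot).

Lemma ReD (z w : R[i]) : complex.Re (z + w) = complex.Re z + complex.Re w.
Proof. by case: z; case: w. Qed.

Lemma ReZ a (z : R[i]) : complex.Re (a%:C * z) = a * complex.Re z.
Proof. by case: z => x y /=; rewrite mul0r subr0. Qed.

Lemma rdotC f g : rdot f g = rdot g f.
Proof. by rewrite /rdot hermC expr0 mul1r /=; case: (dot g f). Qed.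

Lemma rdotDl f g h : rdot (f + g) h = rdot f h + rdot g h.
Proof. by rewrite /rdot linearDl /= ReD. Qed.

Lemma rdotZl a f g : rdot (a%:C *: f) g = a * rdot f g.
Proof. by rewrite /rdot linearZl_LR/= ReZ. Qed.

Lemma rdotDr f g h : rdot h (f + g) = rdot h f + rdot h g.
Proof. by rewrite !(rdotC h) rdotDl. Qed.

Lemma rdotZr a f g : rdot g (a%:C *: f) = a * rdot g f.
Proof. by rewrite !(rdotC g) rdotZl. Qed.

Lemma rdotNl f g : rdot (- f) g = - rdot f g.
Proof. by rewrite -scaleN1r -(rmorphN1 (real_complex R)) rdotZl mulN1r. Qed.

Lemma rdotNr f g : rdot g (- f) = - rdot g f.
Proof. by rewrite !(rdotC g) rdotNl. Qed.

Lemma rdotBl f g h : rdot (f - g) h = rdot f h - rdot g h.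
Proof. by rewrite rdotDl rdotNl. Qed.

Lemma rdot0l f : rdot 0 f = 0.
Proof. by have := rdotZl 0 0 f; rewrite scaler0 mul0r. Qed.

Lemma dotE f : dot f f = (rdot f f)%:C.
Proof.
have := dnorm_ge0 dot f; rewrite lecE => /andP[/eqP/= i0 _].
by rewrite /rdot [LHS]complexE i0 mulr0 addr0.
Qed.

Lemma rdot_ge0 f : 0 <= rdot f f.
Proof. by have := dnorm_ge0 dot f; rewrite dotE lecR. Qed.

Lemma rdot_eq0 f : rdot f f = 0 -> f = 0.
Proof. by move=> f0; apply/eqP; rewrite -(dnorm_eq0 dot) dotE f0. Qed.

Lemma sqr_hnorm f : norm f ^+ 2 = rdot f f.
Proof. by rewrite sqr_sqrtr// rdot_ge0. Qed.

Lemma hnorm_ge0 f : 0 <= norm f. Proof. exact: sqrtr_ge0. Qed.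

Lemma hnorm0 : norm 0 = 0.
Proof. by rewrite /hnorm -/(rdot 0 0) rdot0l sqrtr0. Qed.

Lemma hnorm0_eq0 f : norm f = 0 -> f = 0.
Proof. by move=> f0; apply: rdot_eq0; rewrite -sqr_hnorm f0 expr0n. Qed.

Lemma hnormZ a f : norm (a%:C *: f) = `|a| * norm f.
Proof.
by rewrite /hnorm -/(rdot _ _) rdotZl rdotZr mulrA -expr2 sqrtrM ?sqr_ge0// sqrtr_sqr.
Qed.

Lemma hnormN f : norm (- f) = norm f.
Proof. by rewrite /hnorm -!/(rdot _ _) rdotNl rdotNr opprK. Qed.

Lemma hnormBC f g : norm (f - g) = norm (g - f).
Proof. by rewrite -hnormN opprB. Qed.

Lemma cauchy_schwarz f g : rdot f g <= norm f * norm g.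
Proof.
have [->|g0] := eqVneq g 0; first by rewrite rdotC rdot0l hnorm0 mulr0.
have gg : 0 < rdot g g by rewrite lt0r rdot_ge0 andbT; apply: contra_neq g0 => /rdot_eq0.
apply: le_trans (ler_norm _) _.
rewrite -(@ler_pXn2r _ 2)// ?nnegrE ?mulr_ge0 ?hnorm_ge0//.
rewrite exprMn !sqr_hnorm real_normK ?num_real//.
have := rdot_ge0 ((rdot g g)%:C *: f - (rdot f g)%:C *: g).
rewrite rdotBl (rdotC ((rdot g g)%:C *: f)) (rdotC ((rdot f g)%:C *: g)) !rdotBl.
rewrite !rdotZl !rdotZr (rdotC g f) => h.
rewrite -subr_ge0 -(pmulr_rge0 _ gg).
by apply: le_trans h _; rewrite le_eqVlt; apply/orP; left; apply/eqP; ring.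
Qed.

Lemma hnormD f g : norm (f + g) <= norm f + norm g.
Proof.
rewrite -(@ler_pXn2r _ 2)// ?nnegrE ?addr_ge0 ?hnorm_ge0//.
rewrite sqrrD !sqr_hnorm rdotDl !rdotDr (rdotC g f).
have := cauchy_schwarz f g; lra.
Qed.

Lemma hnormB_trans f g h : norm (f - h) <= norm (f - g) + norm (g - h).
Proof. by rewrite (le_trans _ (hnormD _ _))// addrA subrK. Qed.

Lemma linear_op0 (T : H -> H) : linear T -> T 0 = 0.
Proof. by move=> lT; have /= := lT (-1) 0 0; rewrite scaler0 addr0 scaleN1r addNr. Qed.

Lemma linear_opD (T : H -> H) f g : linear T -> T (f + g) = T f + T g.
Proof. by move=> lT; have /= := lT 1 f g; rewrite !scale1r. Qed.

Lemma linear_opZ (T : H -> H) (a : R[i]) f : linear T -> T (a *: f) = a *: T f.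
Proof. by move=> lT; have /= := lT a f 0; rewrite (linear_op0 lT) !addr0. Qed.

Lemma linear_opB (T : H -> H) f g : linear T -> T (f - g) = T f - T g.
Proof.
by move=> lT; rewrite (linear_opD _ _ lT) -[- g]scaleN1r (linear_opZ _ _ lT) scaleN1r.
Qed.

Lemma opnorm_ubound (T : H -> H) f : bounded_op dot T ->
  norm (T f) <= opnorm dot T * norm f.
Proof.
move=> [lT [M HM]]; have [->|f0] := eqVneq f 0.
  by rewrite (linear_op0 lT) hnorm0 mulr0.
have nf : 0 < norm f.
  by rewrite lt0r hnorm_ge0 andbT; apply: contra_neq f0 => /hnorm0_eq0.
rewrite -ler_pdivrMr//.
apply: ub_le_sup.
  exists `|M| => _ [g g1 <-]; rewrite (le_trans (HM g))//.
  by rewrite (le_trans (ler_wpM2r (hnorm_ge0 g) (ler_norm M)))// ler_piMr.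
exists ((norm f)^-1%:C *: f) => /=.
  by rewrite hnormZ ger0_norm ?invr_ge0 ?(ltW nf)// mulVf ?gt_eqF.
by rewrite (linear_opZ _ _ lT) hnormZ ger0_norm ?invr_ge0 ?(ltW nf)// mulrC.
Qed.

Lemma opnorm_lbound (T : H -> H) M : 0 <= M ->
  (forall f, norm (T f) <= M * norm f) -> opnorm dot T <= M.
Proof.
move=> M0 HM; apply: ge_sup.
  by exists (norm (T 0)), 0 => //=; rewrite hnorm0.
by move=> _ [g /= g1 <-]; rewrite (le_trans (HM g))// ler_piMr.
Qed.

Lemma opnorm_ge0 (T : H -> H) : bounded_op dot T -> 0 <= opnorm dot T.
Proof.
move=> [lT [M HM]]; apply: ub_le_sup.
  exists `|M| => _ [g g1 <-]; rewrite (le_trans (HM g))//.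
  by rewrite (le_trans (ler_wpM2r (hnorm_ge0 g) (ler_norm M)))// ler_piMr.
by exists 0 => /=; rewrite ?(linear_op0 lT)// hnorm0.
Qed.

Lemma bounded_op_comp (S T : H -> H) :
  bounded_op dot S -> bounded_op dot T -> bounded_op dot (S \o T).
Proof.
move=> bS bT; split=> [a f g /=|]; first by rewrite bT.1 bS.1.
exists (opnorm dot S * opnorm dot T) => f; rewrite -mulrA.
apply: le_trans (opnorm_ubound _ bS) _.
by rewrite ler_wpM2l ?opnorm_ge0// opnorm_ubound.
Qed.

Lemma bounded_opB (S T : H -> H) :
  bounded_op dot S -> bounded_op dot T -> bounded_op dot (fun f => S f - T f).
Proof.
move=> bS bT; split=> [a f g /=|].
  by rewrite bT.1 bS.1 scalerBr opprD addrACA.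
exists (opnorm dot S + opnorm dot T) => f.
rewrite mulrDl (le_trans (hnormD _ _))// hnormN.
by apply: lerD; exact: opnorm_ubound.
Qed.

End InnerProduct.

(** * Polynomial calculus of a positive operator *)

Lemma half_expr_cvg0 (R : realType) : (fun n => 2^-1 ^+ n : R) @ \oo --> (0 : R).
Proof. by apply: cvg_expr; rewrite ger0_norm//; lra. Qed.

Lemma le0_half_expr (R : realType) (x K : R) : (forall n, x <= 2^-1 ^+ n * K) -> x <= 0.
Proof.
move=> xK; rewrite -[leRHS](mul0r K).
apply: (@cvgr_to_ge nat \oo _ R (fun n => 2^-1 ^+ n * K)).
  by apply: cvgM; [exact: half_expr_cvg0|exact: cvg_cst].
exact: nearW.
Qed.

Section PolynomialCalculus.
Context (R : realType) (H : lmodType R[i]) (dot : {dot H for Num.conj}).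
Implicit Types (f g h : H) (a : R) (p q : {poly R}).
Local Notation norm := (@hnorm R H dot).
Local Notation rdot := (rdot dot).

Lemma hnormZc (z : R[i]) f : norm (z *: f) = normc z * norm f.
Proof.
have -> : norm (z *: f) = Num.sqrt ((normc z * norm f) ^+ 2).
  congr Num.sqrt; rewrite dnormZ dotE exprMn sqr_hnorm.
  by rewrite -[`|z|]/((normc z)%:C) -rmorphXn ReZ.
by rewrite sqrtr_sqr ger0_norm// mulr_ge0 ?hnorm_ge0//; case: z => x y; exact: sqrtr_ge0.
Qed.

Section LinearOperator.
Variable N : H -> H.
Hypothesis lN : linear N.

Lemma iter_linear n : linear (iter n N).
Proof.
by elim: n => [|n IH] a f g //=; rewrite IH lN.
Qed.

Lemma op_horner_widen q n f : (size q <= n)%N ->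
  op_horner q N f = \sum_(i < n) (q`_i)%:C *: iter i N f.
Proof.
move=> qn; rewrite /op_horner (big_ord_widen _ (fun i => (q`_i)%:C *: iter i N f) qn).
rewrite big_mkcond/=; apply: eq_bigr => i _; case: ltnP => // qi.
by rewrite nth_default// scale0r.
Qed.

Lemma op_hornerP a p q f :
  op_horner (a *: p + q) N f = a%:C *: op_horner p N f + op_horner q N f.
Proof.
pose n := maxn (size (a *: p + q)) (maxn (size p) (size q)).
rewrite !(@op_horner_widen _ n) ?leq_max ?leqnn ?orbT//.
rewrite scaler_sumr -big_split/=; apply: eq_bigr => i _.
by rewrite coefD coefZ rmorphD rmorphM scalerDl scalerA.
Qed.

Lemma op_hornerC a f : op_horner a%:P N f = a%:C *: f.
Proof.
by rewrite (@op_horner_widen _ 1) ?size_polyC_leq1// big_ord1 coefC.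
Qed.

Lemma op_hornerB p q f : op_horner (p - q) N f = op_horner p N f - op_horner q N f.
Proof.
have := op_hornerP (-1) q p f.
by rewrite rmorphN1 !scaleN1r ![- _ + _]addrC.
Qed.

Lemma op_hornerMX q f : op_horner (q * 'X) N f = op_horner q N (N f).
Proof.
rewrite (@op_horner_widen _ (size q).+1); last first.
  by have [->|q0] := eqVneq q 0; [rewrite mul0r size_poly0|rewrite size_mulX].
rewrite big_ord_recl coefMX/= scale0r add0r /op_horner.
by apply: eq_bigr => i _; rewrite coefMX/= -iterSr.
Qed.

Lemma op_hornerMXC q a f :
  op_horner (q * 'X + a%:P) N f = op_horner q N (N f) + a%:C *: f.
Proof.
have := op_hornerP 1 (q * 'X) a%:P f.
by rewrite !scale1r op_hornerMX op_hornerC.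
Qed.

Lemma op_hornerXn n f : op_horner 'X^n N f = iter n N f.
Proof.
elim: n f => [|n IH] f; first by rewrite expr0 -polyC1 op_hornerC scale1r.
by rewrite exprSr op_hornerMX IH -iterSr.
Qed.

Lemma op_horner0 f : op_horner 0 N f = 0.
Proof. by rewrite -polyC0 op_hornerC scale0r. Qed.

Lemma op_horner_comm q f : op_horner q N (N f) = N (op_horner q N f).
Proof.
elim/poly_ind: q => [|q c IH] in f *; first by rewrite !op_horner0 (linear_op0 lN).
by rewrite !op_hornerMXC IH (linear_opD _ _ lN) (linear_opZ _ _ lN).
Qed.

Lemma op_hornerM p q f : op_horner (p * q) N f = op_horner p N (op_horner q N f).
Proof.
elim/poly_ind: p => [|p c IH] in q f *; first by rewrite mul0r !op_horner0.
rewrite mulrDl -mulrA ['X * q]mulrC mul_polyC addrC op_hornerP IH op_hornerMX.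
by rewrite op_horner_comm op_hornerMXC addrC.
Qed.

Lemma op_horner_linear q : linear (op_horner q N).
Proof.
move=> a f g; rewrite /op_horner scaler_sumr -big_split/=.
apply: eq_bigr => i _; rewrite iter_linear scalerDr !scalerA.
by rewrite [_ * a]mulrC.
Qed.

Lemma op_horner_ker q f : N f = 0 -> op_horner q N f = (q.[0])%:C *: f.
Proof.
move=> Nf0; elim/poly_ind: q => [|q c _]; first by rewrite op_horner0 horner0 scale0r.
rewrite op_hornerMXC Nf0 (linear_op0 (op_horner_linear q)) add0r.
by rewrite !hornerE.
Qed.

End LinearOperator.

Section PositiveOperator.
Variable N : H -> H.
Hypothesis bN : bounded_op dot N.
Hypothesis symN : forall f g, rdot (N f) g = rdot f (N g).
Hypothesis posN : forall f, 0 <= rdot (N f) f.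
Let lN : linear N := bN.1.

Lemma bounded_op_horner q : bounded_op dot (op_horner q N).
Proof.
split; first exact: op_horner_linear.
elim/poly_ind: q => [|q c [M HM]].
  by exists 0 => f; rewrite op_horner0 hnorm0 mul0r.
exists (`|M| * opnorm dot N + `|c|) => f.
rewrite op_hornerMXC mulrDl.
rewrite (le_trans (hnormD _ _ _))// hnormZ lerD// (le_trans (HM _))//.
rewrite (@le_trans _ _ (`|M| * norm (N f)))//.
  by rewrite ler_wpM2r ?hnorm_ge0// ler_norm.
by rewrite -mulrA ler_wpM2l// opnorm_ubound.
Qed.

Lemma rdot_suml n (F : 'I_n -> H) g : rdot (\sum_i F i) g = \sum_i rdot (F i) g.
Proof.
elim/big_rec2: _ => [|i x y _ <-]; first by rewrite rdot0l.
by rewrite rdotDl.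
Qed.

Lemma iter_sym n f g : rdot (iter n N f) g = rdot f (iter n N g).
Proof. by elim: n => [|n IH] //= in g *; rewrite symN IH -iterSr. Qed.

Lemma op_horner_sym q f g : rdot (op_horner q N f) g = rdot f (op_horner q N g).
Proof.
rewrite (rdotC _ f) /op_horner !rdot_suml; apply: eq_bigr => i _.
by rewrite !rdotZl iter_sym (rdotC _ f).
Qed.

Let hornerform f q := rdot (op_horner q N f) f.

Let hornerform_is_scalar f : scalar (hornerform f).
Proof. by move=> a p q; rewrite /hornerform op_hornerP// rdotDl rdotZl. Qed.

(** The functional [q |-> <q(N) f, f>] is nonnegative on [g s^2] as soon as
    [<g(N) h, h>] is nonnegative for all [h], because [s(N)] is symmetric. This
    applies to [g = 1], to [g = X] and, by the Cauchy-Schwarz inequality, to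
    [g = opnorm N - X]; the truncated moment problem does the rest. *)
Lemma op_horner_ge0 q f : (forall t, 0 <= t <= opnorm dot N -> 0 <= q.[t]) ->
  0 <= rdot (op_horner q N f) f.
Proof.
move=> q0; have := opnorm_ge0 bN; rewrite le_eqVlt => /orP[/eqP M0|M0].
  have N0 g : N g = 0.
    apply/(@hnorm0_eq0 _ _ dot)/eqP; rewrite eq_le hnorm_ge0 andbT.
    by rewrite -(mul0r (norm g)) M0 opnorm_ubound.
  rewrite (op_horner_widen _ _ (leqnSn (size q))) big_ord_recl big1 ?addr0.
    by rewrite rdotZl mulr_ge0 ?rdot_ge0// -horner_coef0 q0// M0 lexx.
  by move=> i _; rewrite /= N0 scaler0.
pose L : {scalar {poly R}} := HB.pack (hornerform f)
  (GRing.isLinear.Build _ _ _ _ _ (hornerform_is_scalar f)).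
rewrite -[leRHS]/(L q); apply: (truncated_moment_ge0 M0) q0 => s; rewrite /= /hornerform expr2.
- by rewrite op_hornerM// op_horner_sym rdot_ge0.
- by rewrite mulrAC op_hornerM// op_hornerMX op_horner_sym.
- rewrite -mulrA op_hornerM// op_horner_sym mulrC op_hornerM//.
  set g := op_horner s N f.
  rewrite op_hornerB op_hornerC -['X]mul1r op_hornerMX -polyC1 op_hornerC scale1r.
  rewrite rdotBl rdotZl subr_ge0 (le_trans (cauchy_schwarz _ _ _))//.
  by rewrite -sqr_hnorm expr2 mulrA ler_wpM2r ?hnorm_ge0// opnorm_ubound.
Qed.

(** The polynomial [e^2 - q^2] is nonnegative on the interval. *)
Lemma op_horner_bound q e f : 0 <= e ->
  (forall t, 0 <= t <= opnorm dot N -> `|q.[t]| <= e) ->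
  norm (op_horner q N f) <= e * norm f.
Proof.
move=> e0 qe; rewrite -(@ler_pXn2r _ 2)// ?nnegrE ?mulr_ge0 ?hnorm_ge0//.
rewrite exprMn !sqr_hnorm -subr_ge0.
have -> : e ^+ 2 * rdot f f - rdot (op_horner q N f) (op_horner q N f) =
    rdot (op_horner ((e ^+ 2)%:P - q * q) N f) f.
  rewrite op_hornerB op_hornerC op_hornerM// rdotBl rdotZl; congr (_ - _).
  by rewrite [RHS]op_horner_sym.
apply: op_horner_ge0 => t /qe qt; rewrite !hornerE subr_ge0 -expr2.
by rewrite -real_normK ?num_real// ler_pXn2r.
Qed.

(** ** Fractional powers *)

Lemma op_powR_approx r B : is_op_powR dot r N B -> exists q : nat -> {poly R},
  (forall e : R, 0 < e -> \forall n \near \oo,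
    forall t : R, 0 <= t <= opnorm dot N -> `|(q n).[t] - t `^ r| <= e) /\
  (forall e : R, 0 < e -> \forall n \near \oo,
    forall f, norm (op_horner (q n) N f - B f) <= e * norm f).
Proof.
move=> [bB [q [q1 q2]]]; exists q; split=> // e e0.
near=> n => f; have bn := bounded_opB (bounded_op_horner (q n)) bB.
rewrite (le_trans (opnorm_ubound _ bn))// ler_wpM2r ?hnorm_ge0//.
rewrite (le_trans (ler_norm _))// ltW// -[X in `|X|]subr0 distrC.
by near: n; move/cvgrPdist_lt : q2; apply.
Unshelve. all: by end_near. Qed.

(** Every Cauchy sequence has a subsequence of this kind, so that this amounts to
    completeness. *)
Definition complete_space := forall (u : nat -> H) (M : R),
  (forall n, norm (u n.+1 - u n) <= M * 2^-1 ^+ n) ->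
  exists l, (fun n => norm (u n - l)) @ \oo --> (0 : R).

(** The operators [q_n(N)], for polynomials [q_n] within [2^-(n + 1)] of [t^r],
    form a Cauchy sequence in operator norm. *)
Lemma op_powR_exists r : complete_space -> 0 < r -> exists B, is_op_powR dot r N B.
Proof.
move=> complete r0.
have e0 n : 0 < 2^-1 ^+ n.+1 :> R by rewrite exprn_gt0.
have /choice[q Hq] n := powR_approx (opnorm dot N) r0 (e0 n).
have qmn m n f : (n <= m)%N ->
    norm (op_horner (q m) N f - op_horner (q n) N f) <= 2^-1 ^+ n * norm f.
  move=> nm; rewrite -op_hornerB; apply: op_horner_bound => [|t tM].
    by rewrite exprn_ge0.
  rewrite !hornerE -(subrK (t `^ r) (q m).[t]) -addrA.
  rewrite (le_trans (ler_normD _ _))// (@le_trans _ _ (2^-1 ^+ n.+1 + 2^-1 ^+ n.+1))//.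
    rewrite lerD//; last by rewrite distrC Hq.
    by rewrite (le_trans (Hq _ _ tM))// ler_wiXn2l// ?invf_le1// ?ler1n.
  by rewrite exprS; lra.
have /choice[B HB] f : exists l, (fun n => norm (op_horner (q n) N f - l)) @ \oo --> (0 : R).
  by apply: (complete _ (norm f)) => n; rewrite mulrC qmn.
have Bq f n : norm (op_horner (q n) N f - B f) <= 2^-1 ^+ n * norm f.
  apply/ler_addgt0Pr => e e_gt0.
  have [m nm Bm] : exists2 m, (n <= m)%N & norm (op_horner (q m) N f - B f) <= e.
    near \oo => m; exists m; first by near: m; exact: nbhs_infty_ge.
    rewrite (le_trans (ler_norm _))// ltW// -[X in `|X|]subr0 distrC.
    by near: m; move/cvgrPdist_lt : (HB f); apply.
  rewrite (le_trans (hnormB_trans _ _ (op_horner (q m) N f) _))// lerD//.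
  by rewrite hnormBC qmn.
have lB : linear B.
  move=> a f g.
  apply/eqP; rewrite -subr_eq0; apply/eqP/(@hnorm0_eq0 _ _ dot)/eqP.
  rewrite eq_le hnorm_ge0 andbT.
  pose K := norm (a *: f + g) + normc a * norm f + norm g.
  have HK n : norm (B (a *: f + g) - (a *: B f + B g)) <= 2^-1 ^+ n * K.
    rewrite (le_trans (hnormB_trans _ _ (op_horner (q n) N (a *: f + g)) _))//.
    rewrite /K -!addrA mulrDr lerD//; first by rewrite hnormBC Bq.
    rewrite op_horner_linear// opprD addrACA (le_trans (hnormD _ _ _))//.
    rewrite mulrDr lerD//; last exact: Bq.
    rewrite -scalerBr hnormZc mulrCA ler_wpM2l ?Bq//.
    by case: (a) => x y; exact: sqrtr_ge0.
  exact: le0_half_expr HK.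
have bB : bounded_op dot B.
  split=> //; exists (opnorm dot (op_horner (q 0) N) + 1) => f.
  have := hnormB_trans dot (B f) (op_horner (q 0) N f) 0.
  rewrite !subr0 => /le_trans; apply; rewrite addrC mulrDl lerD//.
    exact/opnorm_ubound/bounded_op_horner.
  by rewrite hnormBC (le_trans (Bq f 0))// expr0.
exists B; split=> //; exists q; split.
  move=> e e_gt0; near=> n => t tM; rewrite (le_trans (Hq n t tM))//.
  rewrite exprS (@le_trans _ _ (2^-1 ^+ n))//.
    by rewrite ler_piMl ?exprn_ge0//; lra.
  rewrite (le_trans (ler_norm _))// ltW// -[X in `|X|]subr0 distrC.
  by near: n; move/cvgrPdist_lt : (@half_expr_cvg0 R); apply.
apply: (@squeeze_cvgr _ _ _ _ (fun=> 0) (fun n => 2^-1 ^+ n)).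
- near=> n; rewrite opnorm_ge0 ?opnorm_lbound ?exprn_ge0//.
  exact: bounded_opB (bounded_op_horner (q n)) bB.
- exact: cvg_cst.
- exact: half_expr_cvg0.
Unshelve. all: by end_near. Qed.

(** [N^(l + 2) f = 0] implies [|N^(l + 1) f|^2 = <N^l N^(l + 2) f, f> = 0]. *)
Lemma iter_ker l f : (0 < l)%N -> iter l N f = 0 -> N f = 0.
Proof.
elim: l => [//|[//|l] IH] _ Nl0; apply: IH => //; apply: (@rdot_eq0 _ _ dot).
rewrite -iter_sym.
have -> : iter l.+1 N (iter l.+1 N f) = iter l N (iter l.+2 N f).
  by rewrite -!iterD addSnnS.
by rewrite Nl0 (linear_op0 (iter_linear lN l)) rdot0l.
Qed.

(** For an integer [l] with [2 l >= r], [t^(2 l)] is at most a multiple of [t^r]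
    between 0 and [opnorm N], so that [|N^l f|^2 = <N^(2 l) f, f>] is at most a
    multiple of [<N^r f, f>]. *)
Lemma op_powR_ker r B f : 0 < r -> is_op_powR dot r N B ->
  rdot (B f) f <= 0 -> N f = 0.
Proof.
move=> r0 /op_powR_approx[q [q1 q2]] Bf.
have := opnorm_ge0 bN; rewrite le_eqVlt => /orP[/eqP M0|].
  apply/(@hnorm0_eq0 _ _ dot)/eqP; rewrite eq_le hnorm_ge0 andbT.
  by rewrite -(mul0r (norm f)) M0 opnorm_ubound.
set M := opnorm dot N => M0.
have [l l0 rl] : exists2 l, (0 < l)%N & r <= (l + l)%:R.
  exists (Num.bound r).+1 => //.
  rewrite (le_trans (ltW (archi_boundP (ltW r0))))// ler_nat addSn.
  exact: leq_trans (leqnSn _) (leq_addr _ _).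
pose c := M `^ r / M ^+ (l + l).
have c0 : 0 < c by rewrite divr_gt0 ?powR_gt0 ?exprn_gt0.
have ct t : 0 <= t <= M -> c * t ^+ (l + l) <= t `^ r.
  move=> /andP[t0 tM]; have -> : c * t ^+ (l + l) = M `^ r * (t / M) ^+ (l + l).
    by rewrite /c exprMn exprVn mulrAC mulrA mulrAC.
  have -> : t `^ r = M `^ r * (t / M) `^ r.
    by rewrite -powRM ?divr_ge0 ?(ltW M0)// mulrC divfK// gt_eqF.
  rewrite ler_wpM2l ?powR_ge0// -powR_mulrn ?divr_ge0 ?(ltW M0)//.
  have [->|t_neq0] := eqVneq t 0.
    by rewrite mul0r !powR0// ?gt_eqF// (lt_le_trans r0).
  apply: ger_powR => //; rewrite divr_gt0// ?lt0r ?t_neq0//=.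
  by rewrite ler_pdivrMr// mul1r.
have cl e : 0 < e -> c * rdot (iter l N f) (iter l N f) <= 2 * e * norm f ^+ 2.
  move=> e0; near \oo => n.
  have qn t : 0 <= t <= M -> `|(q n).[t] - t `^ r| <= e.
    by move: t; near: n; exact: q1.
  have Bn : norm (op_horner (q n) N f - B f) <= e * norm f.
    by move: f {Bf}; near: n; exact: q2.
  have : 0 <= rdot (op_horner (q n - c *: 'X^(l + l) + e%:P) N f) f.
    apply: op_horner_ge0 => t tM; rewrite !hornerE.
    have := qn t tM; have := ct t tM; rewrite ler_norml => ? /andP[? ?]; lra.
  have : rdot (op_horner (q n) N f - B f) f <= e * norm f ^+ 2.
    rewrite (le_trans (cauchy_schwarz _ _ _))// expr2 mulrA.
    by rewrite ler_wpM2r ?hnorm_ge0.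
  have -> : op_horner (q n - c *: 'X^(l + l) + e%:P) N f =
      op_horner (q n) N f - c%:C *: iter (l + l) N f + e%:C *: f.
    rewrite -[e%:P]opprK -polyCN !op_hornerB -mul_polyC op_hornerM// !op_hornerC.
    by rewrite op_hornerXn rmorphN scaleNr opprK.
  rewrite !rdotDl !rdotNl !rdotZl iterD iter_sym -(sqr_hnorm dot f); lra.
have {cl}Nl : rdot (iter l N f) (iter l N f) <= 0.
  rewrite -(pmulr_rle0 _ c0); apply: (@le0_half_expr _ _ (2 * norm f ^+ 2)) => n.
  by rewrite mulrCA mulrA cl// exprn_gt0.
apply: (iter_ker l0); apply/(@rdot_eq0 _ _ dot)/eqP.
by rewrite eq_le Nl rdot_ge0.
Unshelve. all: by end_near. Qed.

End PositiveOperator.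

Lemma adjoint_rdot T S f g : is_adjoint dot T S -> rdot (T f) g = rdot f (S g).
Proof. by move=> [_ TS]; exact: (congr1 (@complex.Re R) (TS f g)). Qed.

Lemma adjoint_sym T S : bounded_op dot T -> is_adjoint dot T S ->
  is_adjoint dot S T.
Proof.
move=> bT [bS TS]; split=> // f g.
transitivity (Num.conj (dot g (S f))); first by rewrite hermC expr0 mul1r.
by rewrite -TS [RHS]hermC expr0 mul1r.
Qed.

Lemma adjoint_comp_sym T S f g : bounded_op dot T -> is_adjoint dot T S ->
  rdot ((S \o T) f) g = rdot f ((S \o T) g).
Proof.
by move=> bT TS; rewrite (adjoint_rdot _ _ (adjoint_sym bT TS)) (adjoint_rdot _ _ TS).
Qed.

Lemma adjoint_comp_pos T S f : bounded_op dot T -> is_adjoint dot T S ->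
  rdot ((S \o T) f) f = rdot (T f) (T f).
Proof. by move=> bT TS; rewrite (adjoint_rdot _ _ (adjoint_sym bT TS)). Qed.

Lemma normal_p_hyponormal r T : complete_space -> 0 < r -> bounded_op dot T ->
  normal_op dot T -> p_hyponormal dot r T.
Proof.
move=> complete r0 bT [S [TS STcomm]].
have [|f g|f|P HP] := op_powR_exists _ _ _ complete r0 (N := S \o T).
- exact: bounded_op_comp TS.1 bT.
- exact: adjoint_comp_sym.
- by rewrite adjoint_comp_pos// rdot_ge0.
exists S, P, P; split=> //; first by rewrite -STcomm.
by move=> f; rewrite subrr linear0l.
Qed.

(** If [T f = 0] then [(S T)^r f = 0], as approximants of [t^r] are small at 0.
    Hence [<(T S)^r f, f> <= 0], which forces [T S f = 0] and [S f = 0]. *)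
Lemma p_hyponormal_ker r T : 0 < r -> bounded_op dot T -> p_hyponormal dot r T ->
  exists2 S, is_adjoint dot T S & forall f, T f = 0 -> S f = 0.
Proof.
move=> r0 bT [S [P [Q [TS HP HQ QP]]]]; exists S => // f Tf0.
have ST := adjoint_sym bT TS.
have bTS := bounded_op_comp bT TS.1.
have symTS g h := adjoint_comp_sym g h TS.1 ST.
have posTS g : 0 <= rdot ((T \o S) g) g by rewrite (adjoint_comp_pos _ TS.1 ST) rdot_ge0.
have Pf0 : P f = 0.
  have bST := bounded_op_comp TS.1 bT.
  have STf : (S \o T) f = 0 by rewrite /= Tf0 (linear_op0 TS.1.1).
  have [q [q1 q2]] := op_powR_approx bST HP.
  apply/(@hnorm0_eq0 _ _ dot)/eqP; rewrite eq_le hnorm_ge0 andbT.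
  apply: (@le0_half_expr _ _ (2 * norm f)) => k.
  have k0 : 0 < 2^-1 ^+ k :> R by rewrite exprn_gt0.
  near \oo => n.
  have qn : `|(q n).[0] - 0 `^ r| <= 2^-1 ^+ k.
    near: n; apply: filterS (q1 _ k0) => m; apply.
    by rewrite lexx opnorm_ge0.
  have Bn : norm (op_horner (q n) (S \o T) f - P f) <= 2^-1 ^+ k * norm f.
    by move: f {Tf0 STf}; near: n; exact: q2.
  move: Bn qn; rewrite (op_horner_ker bST.1 _ STf) powR0 ?gt_eqF// subr0 => Bn qn.
  have := hnormB_trans dot (P f) ((q n).[0]%:C *: f) 0.
  rewrite !subr0 hnormBC hnormZ.
  have := ler_wpM2r (hnorm_ge0 dot f) qn; lra.
have TSf : (T \o S) f = 0.
  apply: (op_powR_ker bTS symTS posTS r0 HQ).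
  have := QP f; rewrite Pf0 sub0r lecE => /andP[_].
  by rewrite -/(rdot _ _) rdotNl oppr_ge0.
by apply: (@rdot_eq0 _ _ dot); rewrite -(adjoint_comp_pos _ TS.1 ST) TSf rdot0l.
Unshelve. all: by end_near. Qed.

End PolynomialCalculus.

(** * The space of square integrable functions *)

Section L2Space.
Context d (X : measurableType d) (R : realType) (mu : {measure set X -> \bar R}).
Local Notation dot := (@L2_dot d X R mu).
Local Notation norm := (hnorm dot).
Local Notation rdot := (rdot dot).
Implicit Types f g h : L2 mu.

Lemma L2_cmeasurable f : cmeasurable f.
Proof. by case: (L2_square_integrable f). Qed.

Lemma ReB : {morph (@complex.Re R) : z1 z2 / z1 - z2}.
Proof. by move=> [? ?] [? ?]. Qed.

Lemma ImB : {morph (@complex.Im R) : z1 z2 / z1 - z2}.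
Proof. by move=> [? ?] [? ?]. Qed.

Lemma cmeasurableB (f g : X -> R[i]) : cmeasurable f -> cmeasurable g ->
  cmeasurable (fun x => f x - g x).
Proof.
move=> mf mg; have := cmeasurableD mf (cmeasurableM (cmeasurable_cst X (-1)) mg).
by under eq_fun do rewrite mulN1r.
Qed.

Lemma L2_subE f g : {ae mu, forall x, (f - g : L2 mu) x = f x - g x}.
Proof.
have -> : f - g = (-1) *: g + f by rewrite scaleN1r addrC.
by apply: filterS (L2_linE (-1) g f) => x ->; rewrite mulN1r addrC.
Qed.

Lemma L2_addE f g : {ae mu, forall x, (f + g : L2 mu) x = f x + g x}.
Proof.
by have := L2_linE 1 f g; rewrite scale1r; apply: filterS => x ->; rewrite mul1r.
Qed.

Lemma L2_scale_ae (a : R[i]) f : {ae mu, forall x, (a *: f : L2 mu) x = a * f x}.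
Proof. exact: L2_pi_ae. Qed.

Lemma L2_zero_ae : {ae mu, forall x, (0 : L2 mu) x = 0}.
Proof.
have -> : (0 : L2 mu) = 0 *: 0 by rewrite scale0r.
by apply: filterS (L2_scale_ae 0 0) => x ->; rewrite mul0r.
Qed.

Lemma L2_exists (f : X -> R[i]) : square_integrable mu f ->
  exists F : L2 mu, {ae mu, forall x, F x = f x}.
Proof.
move=> f2; have f2' : f \in @L2fun_pred d X R mu by apply/asboolP.
by exists (\pi_(L2 mu) (MkL2fun f2'))%qT; exact: L2_pi_ae.
Qed.

Lemma mulr_conj (z : R[i]) : z * Num.conj z = (normc z ^+ 2)%:C.
Proof. by rewrite -normCK rmorphXn; case: z. Qed.

Lemma L2_rdotE f : (rdot f f)%:E = (\int[mu]_x (normc (f x) ^+ 2)%:E)%E.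
Proof.
have [mf If] := (square_integrableP _ _).1 (L2_square_integrable f).
rewrite -[RHS]fineK; last exact: integrable_fin_num.
by congr EFin; apply: eq_Rintegral => x _; rewrite mulr_conj.
Qed.

Lemma L2_rdot_ae f (g : X -> R[i]) : cmeasurable g ->
  {ae mu, forall x, f x = g x} ->
  (rdot f f)%:E = (\int[mu]_x (normc (g x) ^+ 2)%:E)%E.
Proof.
move=> mg fg; rewrite L2_rdotE; apply: ae_eq_integral => //.
- exact/measurable_EFinP/cmeasurable_normc2/L2_cmeasurable.
- exact/measurable_EFinP/cmeasurable_normc2.
- by apply: filterS fg => x /= -> _.
Qed.

Lemma fatou_bound (f : nat -> X -> \bar R) (g : X -> \bar R) (C : \bar R) :
  (forall n, measurable_fun setT (f n)) -> (forall n x, (0 <= f n x)%E) ->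
  (forall x, f^~ x @ \oo --> g x) ->
  (forall n, (\int[mu]_x f n x <= C)%E) -> (\int[mu]_x g x <= C)%E.
Proof.
move=> mf f0 fg fC.
have -> : (\int[mu]_x g x = \int[mu]_x limn_einf (f^~ x))%E.
  apply: eq_integral => x _; rewrite is_cvg_limn_einfE; last by apply/cvg_ex; exists (g x).
  exact/esym/cvg_lim.
apply: le_trans (fatou _ _ _ _) _ => //.
rewrite limn_einf_lim; apply: lime_le; first exact: is_cvg_einfs.
apply: nearW => n; apply: le_trans (fC n).
by apply: ereal_inf_lbound; exists n => /=.
Qed.

Lemma Re_le_normc (z : R[i]) : `|complex.Re z| <= normc z.
Proof. by case: z => x y /=; rewrite -sqrtr_sqr ler_wsqrtr// lerDl sqr_ge0. Qed.

Lemma Im_le_normc (z : R[i]) : `|complex.Im z| <= normc z.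
Proof. by case: z => x y /=; rewrite -sqrtr_sqr ler_wsqrtr// lerDr sqr_ge0. Qed.

Lemma normc_ge0 (z : R[i]) : 0 <= normc z.
Proof. by case: z => x y; exact: sqrtr_ge0. Qed.

(** The series of the [2^n |u_(n+1) - u_n|^2] has a finite integral, hence
    converges almost everywhere, to [G]. Where it does, the sequence converges
    pointwise, and Fatou's lemma bounds the distance to the limit. *)
Section Completeness.
Variables (u : nat -> L2 mu) (M : R).
Hypothesis uM : forall n, norm (u n.+1 - u n) <= M * 2^-1 ^+ n.

Let M0 : 0 <= M.
Proof. by have := uM 0; rewrite expr0 mulr1; apply: le_trans; exact: hnorm_ge0. Qed.

Let un_um n m : norm (u (n + m)%N - u n) <= M * 2^-1 ^+ n * 2.
Proof.
suff : norm (u (n + m)%N - u n) <= M * 2^-1 ^+ n * (2 - 2 * 2^-1 ^+ m).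
  move/le_trans; apply; apply: ler_wpM2l; first by rewrite mulr_ge0// exprn_ge0.
  by rewrite lerBlDr lerDl mulr_ge0// exprn_ge0.
elim: m => [|m IH]; first by rewrite addn0 subrr hnorm0 expr0 mulr1 subrr mulr0.
rewrite (le_trans (hnormB_trans _ _ (u (n + m)%N) _))// addnS.
rewrite (le_trans (lerD (uM _) IH))// exprD exprS; lra.
Qed.

Let diff n x := (u n.+1 x - u n x : R[i]).

Let mdiff n : cmeasurable (diff n).
Proof. exact: cmeasurableB (L2_cmeasurable _) (L2_cmeasurable _). Qed.

Let w n x : \bar R := (2 ^+ n * normc (diff n x) ^+ 2)%:E.

Let mw n : measurable_fun setT (w n).
Proof.
apply/measurable_EFinP; apply: measurable_funM => //.
exact: cmeasurable_normc2 (mdiff n).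
Qed.

Let w0 n x : (0 <= w n x)%E.
Proof. by rewrite lee_fin mulr_ge0 ?sqr_ge0// exprn_ge0. Qed.

Let G x := (\sum_(n <oo) w n x)%E.

Let intG : (\int[mu]_x G x < +oo)%E.
Proof.
rewrite integral_nneseries//.
apply: (@le_lt_trans _ _ (\sum_(n <oo) (M ^+ 2 * 2^-1 ^+ n)%:E)%E).
  apply: lee_nneseries => [n *|n *]; first by apply: integral_ge0 => x _; exact: w0.
  rewrite /w; under eq_integral do rewrite EFinM.
  rewrite ge0_integralZl//; last 2 first.
  - exact/measurable_EFinP/cmeasurable_normc2/mdiff.
  - by move=> x _; rewrite lee_fin sqr_ge0.
  rewrite -(L2_rdot_ae (mdiff n) (L2_subE (u n.+1) (u n))) -EFinM lee_fin -sqr_hnorm.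
  have : norm (u n.+1 - u n) ^+ 2 <= (M * 2^-1 ^+ n) ^+ 2.
    by rewrite ler_pXn2r ?nnegrE ?hnorm_ge0// mulr_ge0// exprn_ge0.
  move=> /(ler_wpM2l (exprn_ge0 n (ler0n R 2)))/le_trans; apply.
  rewrite exprMn mulrCA ler_wpM2l ?sqr_ge0// expr2 mulrA -exprMn mulfV ?pnatr_eq0//.
  by rewrite expr1n mul1r.
have gs k : (\sum_(0 <= i < k) (M ^+ 2 * 2^-1 ^+ i)%:E <= (M ^+ 2 * (1 - 2^-1)^-1)%:E)%E.
  rewrite sumEFin lee_fin; have h : `|2^-1| < 1 :> R by rewrite ger0_norm//; lra.
  have := @geometric_le_lim R k (M ^+ 2) 2^-1 (sqr_ge0 _); rewrite /series/=; apply => //.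
apply: (@le_lt_trans _ _ (M ^+ 2 * (1 - 2^-1)^-1)%:E); last exact: ltry.
apply: lime_le; last by apply: nearW => k; exact: gs.
by apply: is_cvg_nneseries => n _ _; rewrite lee_fin mulr_ge0 ?sqr_ge0// exprn_ge0.
Qed.

Let mG : measurable_fun setT G.
Proof. exact: ge0_emeasurable_sum. Qed.

Let Z := [set x | (G x < +oo)%E].

Let mZ : measurable Z.
Proof.
have := emeasurable_fun_infty_o measurableT mG +oo%E; by rewrite setTI.
Qed.

Let aeZ : {ae mu, forall x, Z x}.
Proof.
have /integrable_ae : mu.-integrable setT G.
  apply/integrableP; split=> //.
  under eq_integral do rewrite gee0_abs ?nneseries_ge0//; exact: intG.
move=> /(_ measurableT); apply: filterS => x /(_ I).
by rewrite fin_numE /Z/= lt_neqAle leey => /andP[_ ->].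
Qed.

(* The sequence is set to 0 on a null set, so that it converges everywhere. *)
Let v n x : R[i] := (\1_Z x : R)%:C * u n x.

Let mv n : cmeasurable (v n).
Proof.
apply: cmeasurableM; last exact: L2_cmeasurable.
by split; [exact: measurable_indic|exact: measurable_cst].
Qed.

Let vu n : {ae mu, forall x, v n x = u n x}.
Proof. by apply: filterS aeZ => x Zx; rewrite /v indicE mem_set// mul1r. Qed.

(* [|a| <= s + |a|^2 / s] turns the summability of [2^n |u_(n+1) - u_n|^2] into
   that of [|u_(n+1) - u_n|]. *)
Let cvg_part (phi : R[i] -> R) : {morph phi : z1 z2 / z1 - z2} ->
  (forall z, `|phi z| <= normc z) -> forall x, cvgn (fun n => phi (v n x)).
Proof.
move=> phiB phi_le x; rewrite /v indicE.
have [xZ|xZ] := boolP (x \in Z); last first.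
  under eq_fun do rewrite mul0r; exact: is_cvg_cst.
under eq_fun do rewrite mul1r.
pose a := fun n => phi (diff n x).
suff ca : cvgn (series a).
  have -> : (fun n => phi (u n x)) = (fun n => phi (u 0 x) + series a n).
    apply/funext => n; rewrite /series /=; elim: n => [|n IH].
      by rewrite big_geq// addr0.
    by rewrite big_nat_recr//= addrA -IH /a phiB addrC subrK.
  by apply: is_cvgD => //; exact: is_cvg_cst.
apply: normed_cvg.
apply: (@series_le_cvg _ _ (fun n => 2^-1 ^+ n + 2 ^+ n * normc (diff n x) ^+ 2)) => [n|n|n|].
- exact: normr_ge0.
- by rewrite addr_ge0 ?exprn_ge0// mulr_ge0 ?sqr_ge0// exprn_ge0.
- rewrite /= (le_trans (phi_le _))//; set c := normc _.
  have c0 : 0 <= c by exact: normc_ge0.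
  have p0 : 0 < 2^-1 ^+ n :> R by rewrite exprn_gt0.
  have p1 : 2 ^+ n * 2^-1 ^+ n = 1 :> R by rewrite -exprMn mulfV ?expr1n// pnatr_eq0.
  have q0 : 0 < 2 ^+ n :> R by rewrite exprn_gt0.
  have [cp|pc] := leP c (2^-1 ^+ n).
    by rewrite ler_wpDr// mulr_ge0 ?sqr_ge0// ltW.
  rewrite ler_wpDl ?(ltW p0)// expr2 mulrA ler_peMl// -[leLHS]p1 ler_wpM2l ?ltW//.
apply: nondecreasing_is_cvgn.
  apply: nondecreasing_series => n _ _.
  by rewrite addr_ge0 ?exprn_ge0// mulr_ge0 ?sqr_ge0// exprn_ge0.
have Gf : G x \is a fin_num.
  by rewrite ge0_fin_numE ?nneseries_ge0//; move: xZ; rewrite inE.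
exists (2 + fine (G x)) => _ [k _ <-]; rewrite /series/= big_split/= lerD//.
  have half1 : `|2^-1| < 1 :> R by rewrite ger0_norm//; lra.
  have := @geometric_le_lim R k 1 2^-1 ler01; rewrite /series/= mul1r.
  under eq_bigr do rewrite mul1r; move=> /(_ _ half1)/le_trans; apply => //.
  have -> : (1 - 2^-1)^-1 = 2 :> R by field.
  by [].
rewrite -lee_fin fineK// -sumEFin; apply: nneseries_lim_ge => n *; exact: w0.
Qed.

Let l x : R[i] := limn (fun n => complex.Re (v n x)) +i* limn (fun n => complex.Im (v n x)).

Let ml : cmeasurable l.
Proof.
split.
- apply: (measurable_fun_cvg (h := fun n x => complex.Re (v n x))) => [m|x _].
    by have [] := mv m.
  exact: (cvg_part ReB Re_le_normc).
- apply: (measurable_fun_cvg (h := fun n x => complex.Im (v n x))) => [m|x _].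
    by have [] := mv m.
  exact: (cvg_part ImB Im_le_normc).
Qed.

Let int_l n : (\int[mu]_x (normc (l x - v n x) ^+ 2)%:E <= ((M * 2^-1 ^+ n * 2) ^+ 2)%:E)%E.
Proof.
apply: (@fatou_bound (fun m x => (normc (v (n + m)%N x - v n x) ^+ 2)%:E)).
- by move=> m; apply/measurable_EFinP/cmeasurable_normc2/cmeasurableB.
- by move=> m x; rewrite lee_fin sqr_ge0.
- move=> x; apply: cvg_EFin; first exact: nearW.
  rewrite /comp/= normc2E ReB ImB.
  under eq_fun do rewrite normc2E ReB ImB.
  have shift (phi : R[i] -> R) : cvgn (fun m => phi (v m x)) ->
      (fun m => (phi (v (n + m)%N x) - phi (v n x)) ^+ 2) @ \oo -->
      (limn (fun m => phi (v m x)) - phi (v n x)) ^+ 2.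
    move=> c; have c' : (fun m => phi (v (n + m)%N x)) @ \oo --> limn (fun m => phi (v m x)).
      exact: (cvg_comp _ _ (cvg_addnl n) c).
    under eq_fun do rewrite expr2; rewrite expr2.
    by apply: cvgM; apply: cvgB c' _; exact: cvg_cst.
  apply: cvgD; apply: shift.
    exact: (cvg_part ReB Re_le_normc).
  exact: (cvg_part ImB Im_le_normc).
- move=> m; rewrite -(L2_rdot_ae (f := u (n + m)%N - u n)); last 2 first.
  + exact: cmeasurableB.
  + have ae1 := L2_subE (u (n + m)%N) (u n).
    by apply: filterS3 ae1 (vu (n + m)%N) (vu n) => x -> -> ->.
  rewrite lee_fin -sqr_hnorm ler_pXn2r ?nnegrE ?hnorm_ge0//.
  by rewrite mulr_ge0// mulr_ge0// exprn_ge0.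
Qed.

Lemma L2_cauchy_cvg : exists f, (fun n => norm (u n - f)) @ \oo --> (0 : R).
Proof.
have l2 : square_integrable mu l.
  have [f0 Hf0] : exists f0 : L2 mu, {ae mu, forall x, f0 x = l x - v 0 x}.
    apply: L2_exists; split; first exact: cmeasurableB.
    by rewrite (le_lt_trans (int_l 0))// ltry.
  have [_ I] := L2_square_integrable (f0 + u 0).
  split=> //; apply: le_lt_trans I; rewrite le_eqVlt; apply/orP; left; apply/eqP.
  apply: ae_eq_integral => //.
  - exact/measurable_EFinP/cmeasurable_normc2.
  - exact/measurable_EFinP/cmeasurable_normc2/L2_cmeasurable.
  - apply: filterS3 (L2_addE f0 (u 0)) Hf0 (vu 0) => x e1 e2 e3 _ /=.
    by rewrite e1 e2 e3 subrK.
have [f fl] := L2_exists l2; exists f.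
have unf n : norm (u n - f) <= 2^-1 ^+ n * (2 * M).
  rewrite hnormBC -(@ler_pXn2r _ 2) ?nnegrE ?hnorm_ge0// ?mulr_ge0 ?exprn_ge0//.
  rewrite sqr_hnorm -lee_fin (@L2_rdot_ae _ (fun x => l x - v n x)); last 2 first.
  - exact: cmeasurableB.
  - by apply: filterS3 (L2_subE f (u n)) fl (vu n) => x -> -> ->.
  by have -> : 2^-1 ^+ n * (2 * M) = M * 2^-1 ^+ n * 2 by ring.
apply: (@squeeze_cvgr _ _ _ _ (fun=> 0) (fun n => 2^-1 ^+ n * (2 * M))).
- by apply: nearW => n; rewrite hnorm_ge0 unf.
- exact: cvg_cst.
- rewrite -(mul0r (2 * M)); apply: cvgM; [exact: half_expr_cvg0|exact: cvg_cst].
Qed.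

End Completeness.

Lemma L2_complete : complete_space dot.
Proof. by move=> u M uM; exact: L2_cauchy_cvg uM. Qed.

End L2Space.

(** * Conditional expectation of nonnegative functions *)

Section ConditionalExpectationTheory.
Local Open Scope ereal_scope.
Context d1 d2 (X : measurableType d1) (Y : measurableType d2) (R : realType).
Variables (phi : X -> Y) (mphi : measurable_fun setT phi).
Variable mu : {measure set X -> \bar R}.

Let mpre B : measurable B -> measurable (phi @^-1` B).
Proof. by move=> mB; rewrite -[_ @^-1` _]setTI; exact: mphi. Qed.

Section WeightedImage.
Variables (h : X -> \bar R) (mh : measurable_fun setT h) (h0 : forall x, 0 <= h x).

(** For [h = 1] this is the restriction of [mu] to the sigma-algebra induced by
    [phi]; in general its density with respect to that restriction is the
    conditional expectation of [h]. *)
Definition weighted_image (B : set Y) : \bar R := \int[mu]_(x in phi @^-1` B) h x.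

Local Notation W := weighted_image.

Let W0 : W set0 = 0.
Proof. by rewrite /W preimage_set0 integral_set0. Qed.

Let W_ge0 B : 0 <= W B.
Proof. by apply: integral_ge0 => x _. Qed.

Let W_sigma_additive : semi_sigma_additive W.
Proof.
move=> F mF tF mUF; rewrite /W preimage_bigcup ge0_integral_bigcup//.
- by apply: is_cvg_ereal_nneg_natsum_cond => n _ _; exact: W_ge0.
- by move=> k; exact: mpre.
- exact: measurable_funTS.
- apply/trivIsetP => /= i j _ _ ij; rewrite -preimage_setI.
  by move/trivIsetP : tF => /(_ _ _ _ _ ij) ->//; rewrite preimage_set0.
Qed.

HB.instance Definition _ := isMeasure.Build _ _ _ W W0 W_ge0 W_sigma_additive.

Definition weighted_image_measure : {measure set Y -> \bar R} := W.

Import HBNNSimple.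

(** Proved on simple functions, then by monotone convergence; the case where
    [h x] is infinite and [a (phi x)] is 0 is where the product is not
    continuous. *)
Lemma integral_weighted_image (a : Y -> \bar R) B : measurable B ->
  measurable_fun B a -> (forall y, B y -> 0 <= a y) ->
  \int[W]_(y in B) a y = \int[mu]_(x in phi @^-1` B) (a (phi x) * h x).
Proof.
move=> mB ma a0; pose f_ := nnsfun_approx mB ma.
transitivity (limn (fun n => \int[W]_(x in B) (f_ n x)%:E)).
  rewrite -monotone_convergence//.
  - apply: eq_integral => y /[!inE] yB; apply/esym/cvg_lim => //.
    exact: cvg_nnsfun_approx.
  - by move=> n; exact/measurable_EFinP/measurable_funP.
  - by move=> n y _; rewrite lee_fin.
  - by move=> y _ m n mn; rewrite lee_fin; exact/lefP/nd_nnsfun_approx.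
rewrite [X in limn X](_ : _ =
    (fun n => \int[mu]_(x in phi @^-1` B) ((f_ n (phi x))%:E * h x))).
  rewrite -monotone_convergence//; last 4 first.
  - exact: mpre.
  - move=> n; apply: emeasurable_funM; last exact: measurable_funTS.
    apply/measurable_funTS; apply/measurable_EFinP.
    exact: (measurableT_comp (measurable_funP (f_ n)) mphi).
  - by move=> n x _; rewrite mule_ge0// lee_fin.
  - move=> x _ m n mn; apply: lee_wpmul2r => //; rewrite lee_fin.
    exact/lefP/nd_nnsfun_approx.
  apply: eq_integral => x /[!inE] phiBx; apply/cvg_lim => //.
  have c : EFin \o f_^~ (phi x) @ \oo --> a (phi x) by exact: cvg_nnsfun_approx.
  have [hoo|hfin] := eqVneq (h x) +oo; last first.
    apply: cvgeZr c; rewrite fin_numE hfin andbT.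
    by rewrite gt_eqF// (lt_le_trans _ (h0 x)).
  rewrite hoo.
  have [a00|an0] := eqVneq (a (phi x)) 0.
    have fx0 n : (f_ n (phi x))%:E = 0.
      apply/eqP; rewrite eq_le; apply/andP; split; last by rewrite lee_fin.
      by rewrite -a00 /f_ nnsfun_approxE; exact: le_approx.
    under eq_fun do rewrite fx0 mul0e; rewrite a00 mul0e; exact: cvg_cst.
  apply: cvgeM c _; last exact: cvg_cst.
  by apply: mule_def_neq0_infty.
apply/funext => n.
have mfn r : measurable (phi @^-1` (f_ n @^-1` [set r])) by exact: mpre.
have hind r : \int[mu]_(x in phi @^-1` B) ((\1_(f_ n @^-1` [set r]) (phi x))%:E * h x) =
    W (f_ n @^-1` [set r] `&` B).
  rewrite /W preimage_setI setIC integral_mkcondr; apply: eq_integral => x _.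
  rewrite patchE indicE; case: ifPn => [|].
    by rewrite inE/= => xr; rewrite mem_set// mul1e.
  by rewrite notin_setE/= => xr; rewrite memNset// mul0e.
transitivity (\sum_(r \in range (f_ n)) r%:E *
    \int[mu]_(x in phi @^-1` B) ((\1_(f_ n @^-1` [set r]) (phi x))%:E * h x)).
  under eq_integral do rewrite fimfunE -fsumEFin//.
  rewrite ge0_integral_fsum//; last 2 first.
  - by move=> y; exact/measurable_EFinP/measurable_funM.
  - by move=> y x _; rewrite nnfun_muleindic_ge0.
  apply: eq_fsbigr => r _; rewrite integralZl_indic_nnsfun// integral_indic//=.
  by rewrite hind.
transitivity (\sum_(r \in range (f_ n))
    \int[mu]_(x in phi @^-1` B) (r%:E * ((\1_(f_ n @^-1` [set r]) (phi x))%:E * h x))).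
  apply: eq_fsbigr => r /[!inE] -[y _ <-]; rewrite ge0_integralZl//.
  - exact: mpre.
  - apply: emeasurable_funM; last exact: measurable_funTS.
    apply/measurable_funTS/measurable_EFinP.
    apply: (measurableT_comp _ mphi); exact: measurable_indic.
  - by move=> x _; rewrite mule_ge0// lee_fin indicE.
  - by rewrite lee_fin.
rewrite -ge0_integral_fsum//.
- apply: eq_integral => x _; rewrite [in RHS](fimfunE (f_ n)) -fsumEFin// ge0_mule_fsuml.
    by apply: eq_fsbigr => r _; rewrite muleA.
  by move=> r; rewrite nnfun_muleindic_ge0.
- exact: mpre.
- move=> r; rewrite [X in measurable_fun _ X](_ : _ = (fun x => r%:E * (\1_(f_ n @^-1` [set r]) (phi x))%:E * h x)); last first.
    by apply/funext => x; rewrite muleA.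
  apply: emeasurable_funM; last exact: measurable_funTS.
  apply/measurable_funTS/measurable_EFinP/measurable_funM => //.
  apply: (measurableT_comp _ mphi); exact: measurable_indic.
- by move=> r x _; rewrite muleA mule_ge0// nnfun_muleindic_ge0.
Qed.

End WeightedImage.

Definition is_condexp (h : X -> \bar R) (g : Y -> \bar R) :=
  [/\ forall y, 0 <= g y, measurable_fun setT g &
      forall B, measurable B ->
        \int[mu]_(x in phi @^-1` B) h x = \int[mu]_(x in phi @^-1` B) g (phi x)].

Hypothesis sf : sigma_finite setT (pushforward mu phi).

Let m1 : measurable_fun setT (cst 1 : X -> \bar R). Proof. exact: measurable_cst. Qed.
Let p1 (x : X) : 0 <= (1 : \bar R). Proof. by []. Qed.
Let muY := weighted_image_measure m1 p1.

Let muYE B : measurable B -> muY B = mu (phi @^-1` B).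
Proof.
by move=> mB; rewrite /muY /= /weighted_image integral_cst ?mul1e//; exact: mpre.
Qed.

Let sfY : sigma_finite setT muY.
Proof.
have [F FT mF] := sf; exists F => // i; have [mFi Fi] := mF i.
by split=> //; rewrite muYE.
Qed.

Let muYS : {sigma_finite_measure set Y -> \bar R} :=
  HB.pack_for (SigmaFiniteMeasure.type Y R) (Measure.sort muY)
    (isSFinite.Build _ _ _ _ (sfinite_measure_sigma_finite sfY))
    (isSigmaFinite.Build _ _ _ _ sfY).

(** The Radon-Nikodym theorem gives a version for the restriction of [h] to a
    set on which it is bounded and which lies above a set of finite measure;
    countably many such sets cover the space. *)
Lemma condexp_exists (h : X -> R) : measurable_fun setT h -> (forall x, (0 <= h x)%R) ->
  exists g, is_condexp (EFin \o h) g.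
Proof.
move=> mh h0.
have [K [KT ndK mK]] : exists F, [/\ setT = \bigcup_i F i,
    nondecreasing_seq F & forall i, measurable (F i) /\ muYS (F i) < +oo].
  exact/sigma_finiteP.
pose C n := [set x | (h x <= n%:R)%R] `&` phi @^-1` (K n).
have mC n : measurable (C n).
  apply: measurableI; last by apply: mpre; exact: (mK n).1.
  rewrite -[X in measurable X]setTI; exact: measurable_fun_le.
pose D := seqDU C.
have mD n : measurable (D n).
  by apply: measurableD => //; exact: bigsetU_measurable.
have UD : \bigcup_n D n = setT.
  rewrite -seqDU_bigcup_eq -subTset => x _.
  have [k _ xk] : (\bigcup_i K i) (phi x) by rewrite -KT.
  pose m := maxn k (Num.bound (h x)).
  exists m => //; split.
    rewrite /= (le_trans (ltW (archi_boundP (h0 x))))// ler_nat leq_maxr//.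
  by have /subsetPset := ndK _ _ (leq_maxl k (Num.bound (h x))); apply.
pose hD n := (EFin \o h) \_ (D n).
have mhD n : measurable_fun setT (hD n).
  by apply/(measurable_restrictT _ (mD n))/measurable_funTS; exact/measurable_EFinP.
have hD0 n x : 0 <= hD n x by rewrite /hD patchE; case: ifPn; rewrite // lee_fin.
pose nu n := weighted_image_measure (mhD n) (hD0 n).
have nu_fin n : fin_num_fun (nu n : set Y -> \bar R).
  move=> U mU; rewrite ge0_fin_numE ?measure_ge0//.
  apply: (@le_lt_trans _ _ (\int[mu]_(x in C n) n%:R%:E)).
    rewrite /nu/= /weighted_image [leRHS]integral_mkcond integral_mkcond.
    apply: ge0_le_integral => //.
    - by move=> x _; rewrite patchE; case: ifPn.
    - by apply/(measurable_restrictT _ (mpre mU)); exact: measurable_funTS.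
    - by apply/(measurable_restrictT _ (mC n)).
    - move=> x _; rewrite patchE; case: ifPn => [_|_]; last first.
        by rewrite patchE; case: ifPn; rewrite // lee_fin.
      rewrite /hD !patchE; case: ifPn => [|_]; last by case: ifPn; rewrite // lee_fin.
      by rewrite inE => -[Cx _]; rewrite mem_set//= lee_fin; case: Cx.
  rewrite integral_cst//; apply: lte_mul_pinfty => //.
  rewrite (@le_lt_trans _ _ (mu (phi @^-1` K n)))//.
    by apply: le_measure; rewrite ?inE//; [apply: mpre; exact: (mK n).1|move=> x []].
  by have [mKn] := mK n; rewrite /= muYE.
have nu_sf n : sigma_finite setT (nu n).
  by apply: (fin_num_fun_sigma_finite _ (nu_fin n)); rewrite measure0.
pose nuF n : {finite_measure set Y -> \bar R} :=
  HB.pack_for (FiniteMeasure.type Y R) (Measure.sort (nu n))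
    (isFinite.Build _ _ _ _ (nu_fin n))
    (isSFinite.Build _ _ _ _ (sfinite_measure_sigma_finite (nu_sf n)))
    (isSigmaFinite.Build _ _ _ _ (nu_sf n)).
have dom n : nuF n `<< muYS.
  apply/null_content_dominatesP => B mB; rewrite /= muYE// => B0.
  apply: null_set_integral => //; first exact: mpre.
  exact: measurable_funTS.
have /choice[f Hf] n : exists f : Y -> \bar R, [/\ forall y, 0 <= f y,
    measurable_fun setT f & forall B, measurable B ->
    nu n B = \int[mu]_(x in phi @^-1` B) f (phi x)].
  have [f [f0 _ fi fB]] := radon_nikodym_sigma_finite (dom n).
  exists f; split=> // [|B mB]; first exact: measurable_int fi.
  rewrite [LHS]fB// integral_weighted_image//.
    by apply: eq_integral => x _; rewrite mule1.
  exact/measurable_funTS/(measurable_int _ fi).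
exists (fun y => \sum_(n <oo) f n y); split.
- by move=> y; apply: nneseries_ge0 => n _ _; have [] := Hf n.
- by apply: ge0_emeasurable_sum => n; have [] := Hf n.
- move=> B mB; rewrite integral_nneseries//; last 3 first.
  + exact: mpre.
  + move=> n; apply: measurable_funTS; apply: measurableT_comp mphi.
    by have [] := Hf n.
  + by move=> n x _; have [] := Hf n.
  rewrite -{1}(setIT (_ @^-1` _)) -UD setI_bigcupr ge0_integral_bigcup//; last 4 first.
  + by move=> n; apply: measurableI => //; exact: mpre.
  + exact/measurable_funTS/measurable_EFinP.
  + by move=> x _; rewrite lee_fin.
  + by apply: trivIset_setIl; exact: trivIset_seqDU.
  apply: eq_eseriesr => n _; have [_ _ /(_ _ mB) <-] := Hf n.
  by rewrite integral_mkcondr.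
Qed.

Let integral_muY (g : Y -> \bar R) B : measurable B ->
  measurable_fun setT g -> (forall y, 0 <= g y) ->
  \int[muY]_(y in B) g y = \int[mu]_(x in phi @^-1` B) g (phi x).
Proof.
move=> mB mg g0; rewrite integral_weighted_image//; last exact: measurable_funTS.
by apply: eq_integral => x _; rewrite mule1.
Qed.

Let ae_phi (P : Y -> Prop) : {ae muY, forall y, P y} -> {ae mu, forall x, P (phi x)}.
Proof.
move=> [N [mN N0 PN]]; exists (phi @^-1` N); split.
- exact: mpre.
- by rewrite -muYE.
- by move=> x Px; apply: PN.
Qed.

(* On the sets where [g1 <= n], intersected with a set of finite measure, the
   function [g1] is integrable. *)
Let condexp_unique_fin h g1 g2 : is_condexp h g1 -> is_condexp h g2 ->
  {ae muY, forall y, g1 y < +oo -> g1 y = g2 y}.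
Proof.
move=> [g10 mg1 Hg1] [g20 mg2 Hg2].
have [K KT mK] := sfY.
pose C n k := [set y | g1 y <= n%:R%:E] `&` K k.
have mC n k : measurable (C n k).
  apply: measurableI; last exact: (mK k).1.
  rewrite -[X in measurable X]setTI.
  exact: emeasurable_fun_infty_c.
have : {ae muY, forall y, forall n k, C n k y -> g1 y = g2 y}.
  apply: ae_foralln => n; apply: ae_foralln => k.
  apply: integral_ae_eq => //.
  - apply/integrableP; split; first exact: measurable_funTS.
    apply: (@le_lt_trans _ _ (\int[muY]_(y in C n k) n%:R%:E)).
      apply: ge0_le_integral => //.
      + exact/measurableT_comp/measurable_funTS.
      + by move=> y [Cy _]; rewrite gee0_abs.
    rewrite integral_cst//; apply: lte_mul_pinfty => //.
    rewrite (@le_lt_trans _ _ (muY (K k)))//; last exact: (mK k).2.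
    by apply: le_measure; rewrite ?inE//; [exact: (mK k).1|move=> y []].
  - exact: measurable_funTS.
  - by move=> E _ mE; rewrite !integral_muY// -Hg1// Hg2.
apply: filterS => y Hy g1y.
have [k _ Kk] : (\bigcup_i K i) y by rewrite -KT.
apply: (Hy (Num.bound (fine (g1 y))) k); split=> //=.
have g1f : g1 y \is a fin_num by rewrite ge0_fin_numE.
by rewrite -[leLHS]fineK// lee_fin; apply/ltW/archi_boundP/fine_ge0.
Qed.

Lemma condexp_unique h g1 g2 : is_condexp h g1 -> is_condexp h g2 ->
  {ae mu, forall x, g1 (phi x) = g2 (phi x)}.
Proof.
move=> H1 H2; apply: (ae_phi (P := fun y => g1 y = g2 y)).
apply: filterS2 (condexp_unique_fin H1 H2) (condexp_unique_fin H2 H1) => y e1 e2.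
have [/e1//|] := ltP (g1 y) +oo; rewrite leye_eq => /eqP g1y.
by have [/e2//|] := ltP (g2 y) +oo; rewrite leye_eq g1y => /eqP ->.
Qed.

(** The functions [h] and [g \o phi] are densities of measures with the same
    image under [phi], and both sides are integrals of [a] against this image. *)
Lemma condexp_pull_out (h : X -> \bar R) g (a : Y -> R) :
  measurable_fun setT h -> (forall x, 0 <= h x) ->
  measurable_fun setT a -> (forall y, (0 <= a y)%R) -> is_condexp h g ->
  is_condexp (fun x => (a (phi x))%:E * h x) (fun y => (a y)%:E * g y).
Proof.
move=> mh h0 ma a0 [g0 mg Hg]; split.
- by move=> y; rewrite mule_ge0// lee_fin.
- by apply: emeasurable_funM => //; exact/measurable_EFinP.
- move=> B mB; have mgp := measurableT_comp mg mphi.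
  have mae : measurable_fun B (EFin \o a) by exact/measurable_funTS/measurable_EFinP.
  rewrite -(integral_weighted_image mh h0 mB mae); last by move=> y _; rewrite lee_fin.
  have g0p x : 0 <= (g \o phi) x by exact: g0.
  rewrite -(integral_weighted_image mgp g0p mB mae); last first.
    by move=> y _; rewrite lee_fin.
  apply: (@eq_measure_integral _ _ _ _ (weighted_image_measure mgp g0p)
    (weighted_image_measure mh h0)) => E mE _; exact: Hg.
Qed.

End ConditionalExpectationTheory.

Section ConditionalExpectation.
Context d (X : measurableType d) (R : realType) (mu : {measure set X -> \bar R}).
Variable A : set (set X).
Hypothesis A_sigma_algebra : sigma_algebra [set: X] A.
Hypothesis A_sub : A `<=` @measurable d X.
Hypothesis muA_sigma_finite : sigma_finite [set: g_sigma_algebraType A] mu.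
Local Notation Y := (g_sigma_algebraType A).

Let measurableYE (B : set X) : measurable (B : set Y) = A B.
Proof. by rewrite -[LHS]/(<<s A >> B) sigma_algebra_id. Qed.

Let phi : X -> Y := id.

Let mphi : measurable_fun setT phi.
Proof. by move=> _ B; rewrite measurableYE setTI; exact: A_sub. Qed.

Lemma A_measurable_fun d' (Z : measurableType d') (f : X -> Z) :
  measurable_fun setT (f : Y -> Z) -> measurable_fun setT f.
Proof. by move=> mf; exact: (measurableT_comp mf mphi). Qed.

Let is_condexp := (@is_condexp _ _ X Y R phi mu).

Lemma ge0_condexpP (h : X -> R) : measurable_fun setT h -> (forall x, 0 <= h x) ->
  is_condexp (EFin \o h) (ge0_condexp mu A (EFin \o h)).
Proof.
move=> mh h0; rewrite /ge0_condexp.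
have [g [g0 mg Hg]] := condexp_exists mphi muA_sigma_finite mh h0.
case: xgetP => [g' _ [g'0 mg' Hg']|/(_ g)[]].
  by split=> // B; rewrite measurableYE; exact: Hg'.
by split=> // B AB; apply: Hg; rewrite measurableYE.
Qed.

Lemma ge0_condexp_measurable (h : X -> \bar R) :
  measurable_fun setT (ge0_condexp mu A h : Y -> \bar R).
Proof. by rewrite /ge0_condexp; case: xgetP => [g' _ []//|]; rewrite /cst. Qed.

Lemma rcondexp_measurable (h : X -> R) :
  measurable_fun setT (rcondexp mu A h : Y -> R).
Proof.
by apply: measurable_funB; apply: measurableT_comp (@ge0_condexp_measurable _);
  exact: fine_measurable.
Qed.

Lemma condexp_measurable (h : X -> R[i]) : @cmeasurable _ Y R (condexp mu A h).
Proof. by split; exact: rcondexp_measurable. Qed.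

Lemma rcondexp_pull_out (a h : X -> R) :
  measurable_fun setT (a : Y -> R) -> (forall x, 0 <= a x) -> measurable_fun setT h ->
  {ae mu, forall x, rcondexp mu A (fun y => a y * h y) x = a x * rcondexp mu A h x}.
Proof.
move=> ma a0 mh.
have pull (f : X -> R) : measurable_fun setT f -> (forall x, 0 <= f x) ->
    {ae mu, forall x, fine (ge0_condexp mu A (fun y => (a y * f y)%:E) x) =
      a x * fine (ge0_condexp mu A (EFin \o f) x)}.
  move=> mf f0; have ma' := A_measurable_fun ma.
  have H1 : is_condexp (fun y => (a y * f y)%:E) (ge0_condexp mu A (fun y => (a y * f y)%:E)).
    apply: (@ge0_condexpP (fun y => a y * f y)).
      exact: measurable_funM.
    by move=> x; rewrite mulr_ge0.
  have H2 := condexp_pull_out mphi ((measurable_EFinP _ _).2 mf) f0 ma a0 (ge0_condexpP mf f0).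
  have := condexp_unique mphi muA_sigma_finite H1 H2.
  apply: filterS => x; rewrite /phi => ->.
  have := a0 x; rewrite le_eqVlt => /orP[/eqP <-|ax]; first by rewrite mul0e mul0r.
  case: (ge0_condexp mu A _ x) => [r| |] //=.
    by rewrite gt0_muley ?lte_fin// mulr0.
  by rewrite gt0_muleNy ?lte_fin// mulr0.
have hpos : {ae mu, forall x, fine (ge0_condexp mu A (fun y => (Num.max (a y * h y) 0)%:E) x) =
    a x * fine (ge0_condexp mu A (fun y => (Num.max (h y) 0)%:E) x)}.
  have -> : (fun y => (Num.max (a y * h y) 0)%:E) = (fun y => (a y * Num.max (h y) 0)%:E).
    by apply/funext => y; rewrite maxr_pMr// mulr0.
  by apply: pull; [exact: measurable_maxr|move=> y; rewrite le_max lexx orbT].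
have hneg : {ae mu, forall x, fine (ge0_condexp mu A (fun y => (Num.max (- (a y * h y)) 0)%:E) x) =
    a x * fine (ge0_condexp mu A (fun y => (Num.max (- h y) 0)%:E) x)}.
  have -> : (fun y => (Num.max (- (a y * h y)) 0)%:E) = (fun y => (a y * Num.max (- h y) 0)%:E).
    by apply/funext => y; rewrite maxr_pMr// mulr0 mulrN.
  apply: pull; last by move=> y; rewrite le_max lexx orbT.
  apply: measurable_maxr => //; exact: measurableT_comp.
apply: filterS2 hpos hneg => x e1 e2.
by rewrite /rcondexp e1 e2 mulrBr.
Qed.

Lemma condexp_pull_out_ge0 (a : X -> R) (h : X -> R[i]) :
  measurable_fun setT (a : Y -> R) -> (forall x, 0 <= a x) -> cmeasurable h ->
  {ae mu, forall x, condexp mu A (fun y => (a y)%:C * h y) x = (a x)%:C * condexp mu A h x}.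
Proof.
move=> ma a0 [mr mi].
have ImZ (r : R) (z : R[i]) : complex.Im (r%:C * z) = r * complex.Im z.
  by case: z => x y /=; rewrite mul0r addr0.
apply: filterS2 (rcondexp_pull_out ma a0 mr) (rcondexp_pull_out ma a0 mi) => x e1 e2.
rewrite /condexp.
have -> : (fun y => complex.Re ((a y)%:C * h y)) = (fun y => a y * complex.Re (h y)).
  by apply/funext => y; rewrite ReZ.
have -> : (fun y => complex.Im ((a y)%:C * h y)) = (fun y => a y * complex.Im (h y)).
  by apply/funext => y; rewrite ImZ.
rewrite e1 e2.
by apply/eqP; rewrite eq_complex /= !mul0r subr0 addr0 !eqxx.
Qed.

End ConditionalExpectation.

(** * Weighted conditional expectation operators *)

Section Multipliers.
Context d (X : measurableType d) (R : realType) (mu : {measure set X -> \bar R}).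
Variable A : set (set X).
Hypothesis A_sigma_algebra : sigma_algebra [set: X] A.
Hypothesis A_sub : A `<=` @measurable d X.
Local Notation Y := (g_sigma_algebraType A).
Local Notation dot := (@L2_dot d X R mu).
Implicit Types (f g : L2 mu) (a b c : X -> R[i]).

(** The bounded functions measurable for the smaller sigma-algebra: they can be
    pulled out of conditional expectations. *)
Definition multiplier a := @cmeasurable _ Y R a /\ exists M, forall x, normc (a x) <= M.

Lemma A_cmeasurable a : @cmeasurable _ Y R a -> cmeasurable a.
Proof.
by move=> [mr mi]; split;
  [exact: A_measurable_fun A_sigma_algebra A_sub _ _ _ mr
  |exact: A_measurable_fun A_sigma_algebra A_sub _ _ _ mi].
Qed.

Lemma normc_real (r : R) : normc r%:C = `|r|.
Proof. by rewrite /= expr0n addr0 sqrtr_sqr. Qed.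

Lemma normc_conj (z : R[i]) : normc (Num.conj z) = normc z.
Proof. by case: z => x y /=; rewrite sqrrN. Qed.

Lemma multiplierM a b : multiplier a -> multiplier b -> multiplier (fun x => a x * b x).
Proof.
move=> [ma [M HM]] [mb [K HK]]; split; first exact: cmeasurableM.
exists (M * K) => x; rewrite normcM ler_pM//; exact: normc_ge0.
Qed.

Lemma multiplier_conj a : multiplier a -> multiplier (fun x => Num.conj (a x)).
Proof.
move=> [ma [M HM]]; split; first exact: cmeasurable_conj.
by exists M => x; rewrite normc_conj.
Qed.

Lemma multiplierB a b : multiplier a -> multiplier b -> multiplier (fun x => a x - b x).
Proof.
move=> [ma [M HM]] [mb [K HK]]; split; first exact: cmeasurableB.
by exists (M + K) => x; rewrite (le_trans (le_normcD _ _))// normcN lerD.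
Qed.

Lemma multiplier_square_integrable a f : multiplier a ->
  square_integrable mu (fun x => a x * f x).
Proof.
move=> [ma [M HM]]; have [mf If] := (square_integrableP _ _).1 (L2_square_integrable f).
have maf : cmeasurable (fun x => a x * f x).
  by apply: cmeasurableM => //; exact: A_cmeasurable.
apply/square_integrableP; split=> //.
apply: (le_integrable measurableT _ _ (integrableZl measurableT (M ^+ 2) If)).
  exact/measurable_EFinP/cmeasurable_normc2.
have s0 (z : R) : 0 <= z ^+ 2 := sqr_ge0 z.
move=> x _; rewrite /= lee_fin (ger0_norm (s0 _)) (ger0_norm (mulr_ge0 (s0 _) (s0 _))).
rewrite normcM exprMn ler_wpM2r ?sqr_ge0//.
have M0 := le_trans (normc_ge0 (a x)) (HM x).
by rewrite ler_pXn2r ?nnegrE ?normc_ge0.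
Qed.

(** Multiplication by [a] as an operator on classes of functions; it is
    meaningful for a multiplier [a]. *)
Definition amul a f : L2 mu := xget (0 : L2 mu) [set g : L2 mu | {ae mu, forall x, g x = a x * f x}].

Lemma amulE a f : multiplier a -> {ae mu, forall x, amul a f x = a x * f x}.
Proof.
move=> Ma; rewrite /amul; case: xgetP => [g _ //|].
have [g Hg] := L2_exists (multiplier_square_integrable f Ma).
by move=> /(_ g).
Qed.

Lemma eq_amul a b f g : multiplier a -> multiplier b ->
  {ae mu, forall x, a x * f x = b x * g x} -> amul a f = amul b g.
Proof.
move=> Ma Mb ab; apply/L2P.
by apply: filterS3 (amulE f Ma) (amulE g Mb) ab => x -> ->.
Qed.

Lemma amul_amul a b f : multiplier a -> multiplier b ->
  amul a (amul b f) = amul (fun x => a x * b x) f.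
Proof.
move=> Ma Mb; apply: eq_amul => //; first exact: multiplierM.
by apply: filterS (amulE f Mb) => x ->; rewrite mulrA.
Qed.

Lemma amulBl a b f : multiplier a -> multiplier b ->
  amul (fun x => a x - b x) f = amul a f - amul b f.
Proof.
move=> Ma Mb; apply/L2P.
near=> x.
rewrite (near (amulE f (multiplierB Ma Mb)) x)// (near (L2_subE (amul a f) (amul b f)) x)//.
by rewrite (near (amulE f Ma) x)// (near (amulE f Mb) x)// mulrBl.
Unshelve. all: by end_near. Qed.

Lemma amul_linear a : multiplier a -> linear (amul a).
Proof.
move=> Ma c f g; apply/L2P.
near=> x.
rewrite (near (amulE (c *: f + g) Ma) x)// (near (L2_linE c f g) x)//.
rewrite (near (L2_linE c (amul a f) (amul a g)) x)// (near (amulE f Ma) x)//.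
by rewrite (near (amulE g Ma) x)// mulrDr mulrCA.
Unshelve. all: by end_near. Qed.

Lemma ae_eq_L2_dot f g f' g' :
  {ae mu, forall x, f x * Num.conj (g x) = f' x * Num.conj (g' x)} ->
  dot f g = dot f' g'.
Proof.
move=> fg; apply: ae_eq_cintegral fg; apply: cmeasurableM; try apply: cmeasurable_conj;
  exact: L2_cmeasurable.
Qed.

Lemma dot_amul a f g : multiplier a ->
  dot (amul a f) g = dot f (amul (fun x => Num.conj (a x)) g).
Proof.
move=> Ma; apply: ae_eq_L2_dot.
apply: filterS2 (amulE f Ma) (amulE g (multiplier_conj Ma)) => x -> ->.
by rewrite rmorphM /= conjCK mulrCA mulrA.
Qed.

Lemma dot_amulr a f g : multiplier a ->
  dot f (amul a g) = dot (amul (fun x => Num.conj (a x)) f) g.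
Proof.
move=> Ma; have aa : a = fun x => Num.conj (Num.conj (a x)).
  by apply/funext => x; rewrite conjCK.
by rewrite [in LHS]aa -(dot_amul _ _ (multiplier_conj Ma)).
Qed.

Lemma L2_dot_eq f g : (forall h, dot h f = dot h g) -> f = g.
Proof.
move=> fg; apply/eqP; rewrite -subr_eq0 -(dnorm_eq0 dot); apply/eqP.
by rewrite linearBr /= !fg subrr.
Qed.

End Multipliers.

Section WeightedConditionalExpectation.
Context d (X : measurableType d) (R : realType) (mu : {measure set X -> \bar R}).
Variable A : set (set X).
Hypothesis A_sigma_algebra : sigma_algebra [set: X] A.
Hypothesis A_sub : A `<=` @measurable d X.
Hypothesis muA_sigma_finite : sigma_finite [set: g_sigma_algebraType A] mu.
Local Notation Y := (g_sigma_algebraType A).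
Local Notation dot := (@L2_dot d X R mu).
Implicit Types (f g h : L2 mu) (a b c : X -> R[i]).
Local Notation multiplier := (@multiplier d X R A).

Lemma ge0_condexp_ae_eq (h h' : X -> \bar R) :
  measurable_fun setT h -> measurable_fun setT h' ->
  (forall x, (0 <= h x)%E) -> (forall x, (0 <= h' x)%E) ->
  {ae mu, forall x, h x = h' x} -> ge0_condexp mu A h = ge0_condexp mu A h'.
Proof.
move=> mh mh' h0 h'0 hh'.
have E B : A B -> (\int[mu]_(x in B) h x = \int[mu]_(x in B) h' x)%E.
  move=> /A_sub mB; apply: ge0_ae_eq_integral => //; try exact: measurable_funTS.
  by apply: filterS hh' => x /= ->.
rewrite /ge0_condexp; congr xget; apply/seteqP; split=> g [g0 mg gB]; split=> // B AB.
- by rewrite -E// gB.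
- by rewrite E// gB.
Qed.

Lemma condexp_ae_eq a b : cmeasurable a -> cmeasurable b ->
  {ae mu, forall x, a x = b x} -> condexp mu A a = condexp mu A b.
Proof.
move=> [ar ai] [br bi] ab; apply/funext => x; rewrite /condexp /rcondexp.
have E (phi : R[i] -> R) : measurable_fun setT (phi \o a) -> measurable_fun setT (phi \o b) ->
    ge0_condexp mu A (fun y => (Num.max (phi (a y)) 0)%:E) =
    ge0_condexp mu A (fun y => (Num.max (phi (b y)) 0)%:E).
  move=> ma mb; apply: ge0_condexp_ae_eq.
  - by apply/measurable_EFinP; exact: measurable_maxr.
  - by apply/measurable_EFinP; exact: measurable_maxr.
  - by move=> y; rewrite lee_fin le_max lexx orbT.
  - by move=> y; rewrite lee_fin le_max lexx orbT.
  - by apply: filterS ab => y ->.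
rewrite (E (@complex.Re R) ar br) (E (@complex.Im R) ai bi).
rewrite (E (fun z => - complex.Re z)) ?(E (fun z => - complex.Im z)) //;
  exact: measurableT_comp.
Qed.

Variables (u w : X -> R[i]) (T S : L2 mu -> L2 mu).
Hypothesis T_def : is_MwEMu A u w T.
Hypothesis bT : bounded_op dot T.
Hypothesis TS : is_adjoint dot T S.

Let lT : linear T := bT.1.
Let lS : linear S := TS.1.1.

Let T_amul_ge0 (r : X -> R) f : measurable_fun setT (r : Y -> R) ->
  (forall x, 0 <= r x) -> multiplier (fun x => (r x)%:C) ->
  T (amul (fun x => (r x)%:C) f) = amul (fun x => (r x)%:C) (T f).
Proof.
move=> mr r0 Mr; apply/L2P.
have [[muf _] Tf] := T_def f; have [[mug _] Tg] := T_def (amul (fun x => (r x)%:C) f).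
have mruf : cmeasurable (fun y => (r y)%:C * (u y * f y)).
  apply: cmeasurableM => //; exact (A_cmeasurable A_sigma_algebra A_sub Mr.1).
have e : {ae mu, forall y, u y * amul (fun x => (r x)%:C) f y = (r y)%:C * (u y * f y)}.
  by apply: filterS (amulE A_sigma_algebra A_sub f Mr) => y ->; rewrite mulrCA.
have pull := condexp_pull_out_ge0 A_sigma_algebra A_sub muA_sigma_finite mr r0 muf.
near=> x.
rewrite (near (amulE A_sigma_algebra A_sub (T f) Mr) x)// (near Tg x)// (near Tf x)//.
by rewrite (condexp_ae_eq mug mruf e) (near pull x)// mulrCA.
Unshelve. all: by end_near. Qed.

(** Pulling out a nonnegative multiplier is a property of conditional expectation;
    the general case follows by the linearity of [T]. *)
Lemma MwEMu_amul a f : multiplier a -> T (amul a f) = amul a (T f).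
Proof.
move=> [[ar ai] [M aM]].
have part (r : X -> R) : measurable_fun setT (r : Y -> R) ->
    (forall x, `|r x| <= M) -> forall g,
    T (amul (fun x => (r x)%:C) g) = amul (fun x => (r x)%:C) (T g) /\
    multiplier (fun x => (r x)%:C).
  move=> mr rM g.
  have realM (s : X -> R) : measurable_fun setT (s : Y -> R) ->
      (forall x, `|s x| <= M) -> multiplier (fun x => (s x)%:C).
    move=> ms sM; split; first by split=> //; exact: measurable_cst.
    by exists M => x /=; rewrite expr0n addr0 sqrtr_sqr.
  split; last exact: realM.
  pose rp x := Num.max (r x) 0; pose rn x := Num.max (- r x) 0.
  have mrp : measurable_fun setT (rp : Y -> R) by exact: measurable_maxr.
  have mrn : measurable_fun setT (rn : Y -> R).
    by apply: measurable_maxr => //; exact: measurableT_comp.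
  have rp0 x : 0 <= rp x by rewrite le_max lexx orbT.
  have rn0 x : 0 <= rn x by rewrite le_max lexx orbT.
  have Mp : multiplier (fun x => (rp x)%:C).
    apply: realM => // x; rewrite ger0_norm// ge_max (le_trans (ler_norm _))//=.
    exact: le_trans (rM x).
  have Mn : multiplier (fun x => (rn x)%:C).
    apply: realM => // x; rewrite ger0_norm// ge_max (le_trans (ler_norm _)) ?normrN//=.
    exact: le_trans (rM x).
  have -> : (fun x => (r x)%:C) = (fun x => (rp x)%:C - (rn x)%:C).
    apply/funext => x; rewrite -rmorphB; congr _%:C; rewrite /rp /rn.
    by case: (leP (r x) 0) => rx; case: (leP (- r x) 0) => rx'; lra.
  by rewrite !(amulBl A_sigma_algebra A_sub)// (linear_opB _ _ lT) !T_amul_ge0.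
have [e1 M1] := part _ ar (fun x => le_trans (Re_le_normc _) (aM x)) f.
have [e2 M2] := part _ ai (fun x => le_trans (Im_le_normc _) (aM x)) f.
have Ma g : amul a g = amul (fun x => (complex.Re (a x))%:C) g +
    'i%C *: amul (fun x => (complex.Im (a x))%:C) g.
  have M0 : multiplier a by split; [split|exists M].
  apply/L2P; near=> x.
  rewrite (near (amulE A_sigma_algebra A_sub g M0) x)//.
  rewrite (near (L2_addE (amul (fun x => (complex.Re (a x))%:C) g)
    ('i%C *: amul (fun x => (complex.Im (a x))%:C) g)) x)//.
  rewrite (near (L2_scale_ae 'i%C (amul (fun x => (complex.Im (a x))%:C) g)) x)//.
  rewrite (near (amulE A_sigma_algebra A_sub g M1) x)//.
  rewrite (near (amulE A_sigma_algebra A_sub g M2) x)//.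
  by rewrite mulrA -mulrDl -complexE.
by rewrite !Ma (linear_opD _ _ lT) (linear_opZ _ _ lT) e1 e2.
Unshelve. all: by end_near. Qed.

Lemma adjoint_amul a f : multiplier a -> S (amul a f) = amul a (S f).
Proof.
move=> Ma; apply: L2_dot_eq => g.
rewrite -TS.2 [LHS](dot_amulr A_sigma_algebra A_sub _ _ Ma) -MwEMu_amul.
  by rewrite TS.2 [RHS](dot_amulr A_sigma_algebra A_sub _ _ Ma).
exact: multiplier_conj.
Qed.

(* [T f = w * phi f], where [phi f] is measurable for the smaller sigma-algebra. *)
Let phi f := condexp mu A (fun y => u y * f y).

Let mphi f : @cmeasurable _ Y R (phi f).
Proof. exact: condexp_measurable. Qed.

Let T_eq a b f g : multiplier a -> multiplier b ->
  (forall x, a x * phi f x = b x * phi g x) -> amul a (T f) = amul b (T g).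
Proof.
move=> Ma Mb ab; apply: (eq_amul A_sigma_algebra A_sub) => //.
by apply: filterS2 (T_def f).2 (T_def g).2 => x -> ->; rewrite mulrCA ab mulrCA.
Qed.

Hypothesis kerTS : forall f, T f = 0 -> S f = 0.

(* [T] kills [a f - b g], hence so does [S]. *)
Let S_eq a b f g : multiplier a -> multiplier b ->
  (forall x, a x * phi f x = b x * phi g x) -> amul a (S f) = amul b (S g).
Proof.
move=> Ma Mb ab; apply/eqP; rewrite -subr_eq0 -!adjoint_amul// -(linear_opB _ _ lS).
apply/eqP/kerTS; rewrite (linear_opB _ _ lT) !MwEMu_amul//.
by rewrite (T_eq Ma Mb ab) subrr.
Qed.

(** The integral of [a] against the conditional expectation of [F] times the
    conjugate of [G]: equality of these for all [a] is almost everywhere equality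
    of the conditional expectations. *)
Definition wdot a F G : R[i] := dot (amul a F) G.

Let eq_wdot a b F G : (forall x, a x = b x) -> wdot a F G = wdot b F G.
Proof. by move=> /funext ->. Qed.

Let wdot_l p q a b c F F' G : multiplier a -> multiplier b -> multiplier c ->
  amul b F = amul c F' -> (forall x, p x = a x * b x) -> (forall x, q x = a x * c x) ->
  wdot p F G = wdot q F' G.
Proof.
move=> Ma Mb Mc bc pE qE; rewrite /wdot.
have -> : p = fun x => a x * b x by apply/funext.
have -> : q = fun x => a x * c x by apply/funext.
by rewrite -(amul_amul A_sigma_algebra A_sub F Ma Mb) bc (amul_amul A_sigma_algebra A_sub F' Ma Mc).
Qed.

Let wdot_r p q a b c F G G' : multiplier a -> multiplier b -> multiplier c ->
  amul b G = amul c G' -> (forall x, p x = a x * Num.conj (b x)) ->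
  (forall x, q x = a x * Num.conj (c x)) -> wdot p F G = wdot q F G'.
Proof.
move=> Ma Mb Mc bc pE qE; rewrite /wdot.
have -> : p = fun x => Num.conj (b x) * a x by apply/funext => x; rewrite mulrC.
have -> : q = fun x => Num.conj (c x) * a x by apply/funext => x; rewrite mulrC.
rewrite -(amul_amul A_sigma_algebra A_sub F (multiplier_conj Mb) Ma).
rewrite -(amul_amul A_sigma_algebra A_sub F (multiplier_conj Mc) Ma).
rewrite -(dot_amulr A_sigma_algebra A_sub (amul a F) G Mb).
by rewrite -(dot_amulr A_sigma_algebra A_sub (amul a F) G' Mc) bc.
Qed.

Let wdot_T p F G : multiplier p -> wdot p (T F) G = wdot p F (S G).
Proof. by move=> Mp; rewrite /wdot -MwEMu_amul// TS.2. Qed.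

Let wdot_S p F G : multiplier p -> wdot p (S F) G = wdot p F (T G).
Proof. by move=> Mp; rewrite /wdot -adjoint_amul// (adjoint_sym bT TS).2. Qed.

Let wdotB a b F G : multiplier a -> multiplier b ->
  wdot (fun x => a x - b x) F G = wdot a F G - wdot b F G.
Proof.
by move=> Ma Mb; rewrite /wdot (amulBl A_sigma_algebra A_sub)// linearBl.
Qed.

(** The multipliers [al], [be], [ga], [de] are [phi f], [phi (T f)], [phi (S f)]
    and [phi N] times a common positive factor which makes them bounded. They
    give [al (S T f) = be (S f)], [al (T S f) = ga (T f)], [al (T T f) = be (T f)],
    [al (S S f) = ga (S f)], [al (T N) = de (T f)] and [al (S N) = de (S f)]. *)
Section Commutation.
Variable f : L2 mu.
Let N := S (T f) - T (S f).
Variables al be ga de : X -> R[i].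
Hypothesis (Mal : multiplier al) (Mbe : multiplier be) (Mga : multiplier ga) (Mde : multiplier de).
Hypothesis al_be : forall x, al x * phi (T f) x = be x * phi f x.
Hypothesis al_ga : forall x, al x * phi (S f) x = ga x * phi f x.
Hypothesis al_de : forall x, al x * phi N x = de x * phi f x.

Let Mal' := multiplier_conj Mal.

Ltac mult := repeat first [assumption | exact: multiplier_conj | apply: multiplierM].

(* Compute [<m |al|^2 T T f, f>] in two ways, from [al T T f = be T f] and, moving
   both operators to the right, from [al S S f = ga S f]. *)
Let skew_part m : multiplier m ->
  wdot (fun x => m x * (Num.conj (al x) * be x - al x * Num.conj (ga x))) (T f) f = 0.
Proof.
move=> Mm.
transitivity (wdot (fun x => m x * Num.conj (al x) * be x - m x * al x * Num.conj (ga x)) (T f) f).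
  by apply: eq_wdot => x; ring.
rewrite wdotB; [|by mult|by mult].
apply/eqP; rewrite subr_eq0; apply/eqP.
transitivity (wdot (fun x => m x * Num.conj (al x) * al x) (T (T f)) f).
  apply: (@wdot_l _ _ (fun x => m x * Num.conj (al x)) be al) => //; first by mult.
  exact/esym/T_eq.
rewrite wdot_T; last by mult.
rewrite wdot_T; last by mult.
rewrite wdot_T; last by mult.
apply: (@wdot_r _ _ (fun x => m x * al x) al ga) => //.
- by mult.
- exact: S_eq.
- by move=> x; ring.
Qed.

(* The weight [m = conj z / z] (zero where [z] vanishes) turns the weight [z] of
   [skew_part] into its conjugate. *)
Let cross_part e : multiplier e ->
  wdot (fun x => e x * (al x * Num.conj (be x))) (T f) f =
  wdot (fun x => e x * (Num.conj (al x) * ga x)) (T f) f.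
Proof.
move=> Me; pose z x := Num.conj (al x) * be x - al x * Num.conj (ga x).
have Mz : multiplier z by apply: multiplierB; mult.
pose m x := (((normc (z x) ^+ 2)^-1)%:C : R[i]) * (Num.conj (z x) * Num.conj (z x)).
have mzE x : m x * z x = Num.conj (z x).
  have [z0|z0] := eqVneq (z x) 0; first by rewrite /m z0 mulr0 rmorph0.
  rewrite /m -!mulrA [Num.conj (z x) * z x]mulrC mulr_conj.
  rewrite [Num.conj (z x) * _]mulrC mulrA -rmorphM mulVf ?rmorph1 ?mul1r//.
  by rewrite expf_neq0//; apply: contra_neq z0 => /eq0_normc.
have Mm : multiplier m.
  split.
    apply: cmeasurableM; last by apply: cmeasurableM; apply: cmeasurable_conj; exact: Mz.1.
    split; last exact: measurable_cst.
    under eq_fun do rewrite /= -powR_inv1 ?sqr_ge0//.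
    exact: (measurableT_comp (measurable_powR _) (cmeasurable_normc2 Mz.1)).
  exists 1 => x; rewrite /m !normcM normc_real normc_conj -expr2.
  have [->|n0] := eqVneq (normc (z x) ^+ 2) 0; first by rewrite mulr0.
  by rewrite ger0_norm ?invr_ge0 ?sqr_ge0// mulVf.
have := skew_part (multiplierM Me Mm).
rewrite (eq_wdot (b := fun x => e x * (al x * Num.conj (be x)) - e x * (Num.conj (al x) * ga x))).
  by rewrite wdotB; [move/eqP; rewrite subr_eq0 => /eqP|mult|mult].
move=> x; rewrite -/(z x) -mulrA mzE /z rmorphB !rmorphM /= !conjCK; ring.
Qed.

(* This says that [T f] and [S f] have the same conditional norm where [al] does
   not vanish. *)
Let norm_part e : multiplier e ->
  wdot (fun x => e x * (al x * Num.conj (al x))) (T f) (T f) =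
  wdot (fun x => e x * (al x * Num.conj (al x))) (S f) (S f).
Proof.
move=> Me; have Maa := multiplierM Mal Mal'.
transitivity (wdot (fun x => e x * (al x * Num.conj (be x))) (T f) f).
  rewrite wdot_T; last by mult.
  rewrite [RHS]wdot_T; last by mult.
  apply: (@wdot_r _ _ (fun x => e x * al x) al be) => //; first by mult.
  - exact: S_eq.
  - by move=> x; rewrite mulrA.
  - by move=> x; rewrite mulrA.
rewrite cross_part// -[RHS]wdot_T; last by mult.
apply: (@wdot_l _ _ (fun x => e x * Num.conj (al x)) ga al) => //; first by mult.
- exact/esym/T_eq.
- by move=> x; rewrite mulrA.
- by move=> x; ring.
Qed.

(* With [q = |al|^2], the square norm of [q N] is the difference of
   [<q^2 S T f, N> = <q^2 T f, T N>] and [<q^2 T S f, N> = <q^2 S f, S N>], which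
   are the two sides of [norm_part] for [e = al * conj de]. *)
Let amul_commutator : amul (fun x => al x * Num.conj (al x)) N = 0.
Proof.
pose q x := al x * Num.conj (al x).
have Mq : multiplier q by mult.
have qE x : Num.conj (q x) = q x by rewrite /q rmorphM /= conjCK mulrC.
have Mp : multiplier (fun x => q x * q x) by mult.
have Me : multiplier (fun x => al x * Num.conj (de x)) by mult.
have main : wdot (fun x => q x * q x) N N = 0.
  transitivity (wdot (fun x => q x * q x) (S (T f)) N - wdot (fun x => q x * q x) (T (S f)) N).
    by rewrite /wdot -linearBl/= -(linear_opB _ _ (amul_linear A_sigma_algebra A_sub Mp)).
  rewrite (wdot_S (T f) N Mp) (wdot_T (S f) N Mp).
  apply/eqP; rewrite subr_eq0; apply/eqP.
  transitivity (wdot (fun x => al x * Num.conj (de x) * (al x * Num.conj (al x))) (T f) (T f)).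
    apply: (@wdot_r _ _ (fun x => q x * al x) al de) => //; first by mult.
    - exact: T_eq.
    - by move=> x; rewrite /q; ring.
    - by move=> x; rewrite /q; ring.
  rewrite norm_part//; apply: (@wdot_r _ _ (fun x => q x * al x) de al) => //; first by mult.
  - exact/esym/S_eq.
  - by move=> x; rewrite /q; ring.
  - by move=> x; rewrite /q; ring.
apply/eqP; rewrite -(dnorm_eq0 dot) -[X in X == _]/(dot (amul q N) (amul q N)).
rewrite (dot_amulr A_sigma_algebra A_sub _ _ Mq).
rewrite (_ : (fun x => Num.conj (q x)) = q); last by apply/funext.
by rewrite (amul_amul A_sigma_algebra A_sub _ Mq Mq) -/(wdot _ _ _) main.
Qed.

Hypothesis al0 : forall x, al x = 0 -> phi f x = 0.

Lemma commutator_eq0 : N = 0.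
Proof.
pose Z := [set x | normc (phi f x) ^+ 2 = 0].
have mZ : measurable (Z : set Y).
  rewrite -[Z]setTI; exact: (cmeasurable_normc2 (mphi f)) (measurable_set1 0).
pose chi x := (\1_Z x : R)%:C.
have Mchi : multiplier chi.
  split; first by split; [exact: measurable_indic|exact: measurable_cst].
  exists 1 => x; rewrite normc_real indicE; case: (_ \in _); by rewrite ?normr1 ?normr0.
have chi_phi x : chi x * phi f x = 0.
  rewrite /chi indicE; have [|_] := boolP (x \in Z); last by rewrite mul0r.
  by rewrite inE => /eqP; rewrite sqrf_eq0 => /eqP/eq0_normc ->; rewrite mulr0.
have M0 : multiplier (fun=> 0).
  by split; [exact: cmeasurable_cst|exists 0 => x; rewrite normc0].
have amul0 g : amul (fun=> 0) g = 0.
  by apply/L2P; apply: filterS2 (amulE A_sigma_algebra A_sub g M0) (L2_zero_ae mu) => x -> ->; rewrite mul0r.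
(* Where [phi f] vanishes so do [T f], [S f] and therefore [N]. *)
have Tchi : amul chi (T f) = 0.
  by rewrite (T_eq (b := fun=> 0) (g := f) Mchi M0) ?amul0// => x; rewrite mul0r.
have Schi : amul chi (S f) = 0.
  by rewrite (S_eq (b := fun=> 0) (g := f) Mchi M0) ?amul0// => x; rewrite mul0r.
have Nchi : amul chi N = 0.
  rewrite /N (linear_opB _ _ (amul_linear A_sigma_algebra A_sub Mchi)).
  by rewrite -MwEMu_amul// -adjoint_amul// Tchi Schi (linear_op0 lT) (linear_op0 lS) subrr.
have Mq : multiplier (fun x => al x * Num.conj (al x)) by mult.
have e1 := amulE A_sigma_algebra A_sub N Mq; rewrite amul_commutator in e1.
have e2 := amulE A_sigma_algebra A_sub N Mchi; rewrite Nchi in e2.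
apply/L2P; apply: filterS3 (L2_zero_ae mu) e1 e2 => x -> q0 c0.
have [p0|p0] := eqVneq (phi f x) 0.
  have xZ : x \in Z by rewrite inE /Z /mkset p0 normc0 expr0n.
  by move: c0; rewrite /chi indicE xZ mul1r.
move/esym/eqP: q0; rewrite !mulf_eq0 conjC_eq0 orbb => /orP[/eqP ax0|/eqP//].
by case/eqP: p0; exact: al0.
Qed.

End Commutation.

Lemma ker_sub_adjoint_ker_normal : S \o T = T \o S.
Proof.
apply/funext => f /=; apply/eqP; rewrite -subr_eq0; apply/eqP.
set N := S (T f) - T (S f).
pose nrm x := 1 + normc (phi f x) ^+ 2 + normc (phi (T f) x) ^+ 2 +
  normc (phi (S f) x) ^+ 2 + normc (phi N x) ^+ 2.
have mn g := cmeasurable_normc2 (mphi g).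
have nrm_ge1 x : 1 <= nrm x.
  by rewrite /nrm -!addrA lerDl !addr_ge0// sqr_ge0.
have nrm_gt0 x : 0 < nrm x by rewrite (lt_le_trans ltr01).
pose rho x : R[i] := ((nrm x)^-1)%:C.
have mrho : @cmeasurable _ Y R rho.
  split; last exact: measurable_cst.
  rewrite [X in measurable_fun _ X](_ : _ = fun x => nrm x `^ (-1)); last first.
    by apply/funext => x; rewrite powR_inv1// ltW.
  apply: (measurableT_comp (measurable_powR _)).
  by do ![apply: measurable_funD]; rewrite //; exact: mn.
have rhoM g : (forall x, normc (phi g x) ^+ 2 <= nrm x - 1) -> multiplier (fun x => rho x * phi g x).
  move=> gn; split; first exact: cmeasurableM.
  exists 1 => x; rewrite normcM normc_real ger0_norm ?invr_ge0 ?(ltW (nrm_gt0 x))//.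
  rewrite mulrC ler_pdivrMr// mul1r.
  have := gn x; have := sqr_ge0 (normc (phi g x) - 1); have := nrm_gt0 x.
  by move: (nrm x) (normc _) => n r; nra.
have s0 g x : 0 <= normc (phi g x) ^+ 2 := sqr_ge0 _.
have sum4 (p q r s : R) : 0 <= p -> 0 <= q -> 0 <= r -> 0 <= s ->
    let n := 1 + p + q + r + s in [/\ p <= n - 1, q <= n - 1, r <= n - 1 & s <= n - 1].
  by move=> p0 q0 r0 t0 n; rewrite /n; split; lra.
have bound x := sum4 _ _ _ _ (s0 f x) (s0 (T f) x) (s0 (S f) x) (s0 N x).
have Mf : multiplier (fun x => rho x * phi f x).
  by apply: rhoM => x; case: (bound x) => b _ _ _; exact: b.
have MT : multiplier (fun x => rho x * phi (T f) x).
  by apply: rhoM => x; case: (bound x) => _ b _ _; exact: b.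
have MS : multiplier (fun x => rho x * phi (S f) x).
  by apply: rhoM => x; case: (bound x) => _ _ b _; exact: b.
have MN : multiplier (fun x => rho x * phi N x).
  by apply: rhoM => x; case: (bound x) => _ _ _ b; exact: b.
apply: (commutator_eq0 Mf MT MS MN) => x; [exact: mulrAC|exact: mulrAC|exact: mulrAC|].
move/eqP; rewrite mulf_eq0 => /orP[|/eqP//].
by rewrite eq_complex /= invr_eq0 gt_eqF.
Qed.

End WeightedConditionalExpectation.

Theorem theorem2p2 (R : realType) (d : measure_display) (X : measurableType d)
    (mu : {measure set X -> \bar R})
    (mu_complete : measure_is_complete mu)
    (mu_sigma_finite : sigma_finite [set: X] mu)
    (A : set (set X))
    (A_sigma_algebra : sigma_algebra [set: X] A)
    (A_sub : A `<=` @measurable d X)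
    (muA_sigma_finite : sigma_finite [set: g_sigma_algebraType A] mu)
    (u w : X -> R[i])
    (u_dom : condexp_domain mu A u) (w_dom : condexp_domain mu A w)
    (T : L2 mu -> L2 mu)
    (T_def : is_MwEMu A u w T)
    (T_bounded : bounded_op (@L2_dot d X R mu) T)
    (p : R) (p_gt0 : 0 < p) :
  p_hyponormal (@L2_dot d X R mu) p T <-> normal_op (@L2_dot d X R mu) T.
Proof.
split; last exact: normal_p_hyponormal (@L2_complete d X R mu) p_gt0 T_bounded.
move=> /(p_hyponormal_ker p_gt0 T_bounded)[S TS kerTS]; exists S; split=> //.
exact: (ker_sub_adjoint_ker_normal A_sigma_algebra A_sub muA_sigma_finite T_def T_bounded TS kerTS).
Qed.
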